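(* Let $r,d\ge 1$ and let $H$ be a finitely generated verbally closed subgroup of the free solvable group $S_{r,d}$ with $r_{ab}(H)=r$. Then $H=S_{r,d}$.
   Context: For a group $G$, the derived series is $G^{(0)}=G$, $G^{(i+1)}=[G^{(i)},G^{(i)}]$, and $G'=G^{(1)}$. $S_{r,d}=F_r/F_r^{(d)}$, where $F_r$ is the free group of rank $r$ (the free solvable group of rank $r$ and derived length $d$). For a finitely generated subgroup $H\le G$, $r_{ab}(H)$ denotes the minimal number of generators of the abelian group $HG'/G'$. A subgroup $H\le G$ is verbally closed in $G$ if for every group word $w(x_1,\dots,x_n)$ (without constants) and every $h\in H$, if the equation $w(x_1,\dots,x_n)=h$ has a solution in $G$, then it has a solution in $H$. *)

(* Defs.v *)
From mathcomp Require Import all_boot.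
Set Implicit Arguments. Unset Strict Implicit. Unset Printing Implicit Defensive.

Record AbsGroup := MkGroup {
  gcarrier :> Type;
  gmul : gcarrier -> gcarrier -> gcarrier;
  ginv : gcarrier -> gcarrier;
  gone : gcarrier;
  gmulA : forall x y z, gmul x (gmul y z) = gmul (gmul x y) z;
  gmul1g : forall x, gmul gone x = x;
  gmulVg : forall x, gmul (ginv x) x = gone
}.

Section GroupDefs.
Variable G : AbsGroup.

Definition is_subgroup (H : G -> Prop) : Prop :=
  H (gone G) /\ (forall x y, H x -> H y -> H (gmul x y)) /\
  (forall x, H x -> H (ginv x)).

Inductive gen (A : G -> Prop) : G -> Prop :=
| gen_base x : A x -> gen A x
| gen_one : gen A (gone G)
| gen_mul x y : gen A x -> gen A y -> gen A (gmul x y)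
| gen_inv x : gen A x -> gen A (ginv x).

Definition commg (x y : G) : G := gmul (gmul (ginv x) (ginv y)) (gmul x y).

Definition commsub (A B : G -> Prop) : G -> Prop :=
  gen (fun z => exists a b, A a /\ B b /\ z = commg a b).

Fixpoint derived (i : nat) : G -> Prop :=
  match i with
  | 0 => fun _ => True
  | i'.+1 => commsub (derived i') (derived i')
  end.

Definition fin_gen (H : G -> Prop) : Prop :=
  exists (n : nat) (s : 'I_n -> G), forall g, H g <-> gen (fun x => exists i, x = s i) g.

(* H G'/G' is generated by k elements (images of elements of H). *)
Definition ab_gens (H : G -> Prop) (k : nat) : Prop :=
  exists s : 'I_k -> G, (forall i, H (s i)) /\
    forall h, H h -> gen (fun x => (exists i, x = s i) \/ derived 1 x) h.

Definition r_ab_eq (H : G -> Prop) (n : nat) : Prop :=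
  ab_gens H n /\ forall k, ab_gens H k -> n <= k.

End GroupDefs.

Inductive word (n : nat) : Type :=
| wVar : 'I_n -> word n
| wOne : word n
| wMul : word n -> word n -> word n
| wInv : word n -> word n.

Fixpoint weval (G : AbsGroup) (n : nat) (xs : 'I_n -> G) (w : word n) : G :=
  match w with
  | wVar i => xs i
  | wOne => gone G
  | wMul u v => gmul (weval xs u) (weval xs v)
  | wInv u => ginv (weval xs u)
  end.

Definition verbally_closed (G : AbsGroup) (H : G -> Prop) : Prop :=
  forall (n : nat) (w : word n) (h : G), H h ->
    (exists xs : 'I_n -> G, weval xs w = h) ->
    exists xs : 'I_n -> G, (forall i, H (xs i)) /\ weval xs w = h.

Definition is_hom (G K : AbsGroup) (f : G -> K) : Prop :=
  forall x y, f (gmul x y) = gmul (f x) (f y).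

(* (G, x) is the free solvable group S_{r,d} = F_r / F_r^(d) with free basis
   x, characterised by its universal property in the variety of solvable
   groups of derived length <= d (the relatively free group of rank r). *)
Definition is_free_solvable (G : AbsGroup) (r d : nat) (x : 'I_r -> G) : Prop :=
  (forall g, derived d g -> g = gone G) /\
  forall (K : AbsGroup), (forall k, derived d k -> k = gone K) ->
    forall f : 'I_r -> K,
      exists phi : G -> K, is_hom phi /\ (forall i, phi (x i) = f i) /\
        forall psi : G -> K, is_hom psi -> (forall i, psi (x i) = f i) ->
          forall g, psi g = phi g.

(* Main.v *)
Require Import Defs.
From HB Require Import structures.
From mathcomp Require Import all_boot all_order all_algebra.
From mathcomp Require Import boolp functions zify ring.

(* Let S be free solvable with basis x and W_k the iterated wreath product
   obtained from the trivial group by G |-> (G * 'I_r -> int) ><| G.  The Magnus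
   homomorphism D_k : S -> W_k has kernel S^(k), and one shows H S^(k) = S by
   induction on k.  By verbal closedness every h in H is fixed by an
   endomorphism of S with image in H.

   For k = 1 this makes the image of H in Z^r pure, hence everything, since by
   the Smith normal form it would otherwise need fewer than r generators.

   Assume H S^(k) = S and write x_i = a_i h_i with a_i in A = S^(k), h_i in H.
   Modulo S^(k+1), A is a submodule of Z[W_k]^r (Fox derivatives); let N be the
   matrix of coordinates of the a_i.  The endomorphism x_i |-> h_i sends a_i into
   H, with coordinates the i-th row of N - N^2.  As W_k is amenable, y e_j = v (1 - N)
   has a nonzero solution (y, v), and y <> 0 because v = v N forces v = 0.  So
   y a_j lies in H modulo S^(k+1).  For g_i in H above x_i and large n, the
   iterated products (g_i^n - 1) ... (y a_j) are so rigid that an endomorphism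
   fixing one of them has an iterate psi that fixes y a_j and is the identity modulo
   S^(k).  Then y (psi a_j - a_j) = 0, and psi a_j = a_j modulo S^(k+1) because
   Z[W_k] has no zero divisors; since psi maps into H, x_j is in H S^(k+1). *)

Set Implicit Arguments.
Unset Strict Implicit.
Unset Printing Implicit Defensive.

Import Order.TTheory GRing.Theory Num.Theory.

(** * Iterated Magnus wreath products *)

(** Equality and choice on carriers are classical, so that [seq], [\in] and [uniq] apply to group
    elements. *)
HB.instance Definition _ (G : AbsGroup) := gen_eqMixin (gcarrier G).
HB.instance Definition _ (G : AbsGroup) := gen_choiceMixin (gcarrier G).

Section AbsGroupType.
Variable G : AbsGroup.
Implicit Types x y : G.

Lemma gmulgV x : gmul x (ginv x) = gone G.
Proof.
rewrite -[gmul x _]gmul1g -{1}(gmulVg (ginv x)) -gmulA [gmul (ginv x) _]gmulA.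
by rewrite gmulVg gmul1g gmulVg.
Qed.

Lemma gmulg1 x : gmul x (gone G) = x.
Proof. by rewrite -(gmulVg x) gmulA gmulgV gmul1g. Qed.

HB.instance Definition _ :=
  isGroup.Build (gcarrier G) (@gmulA G) (@gmul1g G) gmulg1 (@gmulVg G) gmulgV.

End AbsGroupType.

Section Wreath.
Variables (G : AbsGroup) (r : nat).

Definition shift (g : G) (f : G * 'I_r -> int) : G * 'I_r -> int :=
  fun p => f ((g^-1 * p.1)%g, p.2).

Lemma shift1 f : shift 1%g f = f.
Proof. by apply/funext => -[b i]; rewrite /shift invg1 mul1g. Qed.

Lemma shiftM g h f : shift (g * h)%g f = shift g (shift h f).
Proof. by apply/funext => -[b i]; rewrite /shift /= invgM mulgA. Qed.

Lemma shiftD g f1 f2 : shift g (f1 + f2)%R = (shift g f1 + shift g f2)%R.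
Proof. by []. Qed.

Lemma shift_inj g : injective (shift g).
Proof.
move=> f1 f2 /(congr1 (shift g^-1%g)); by rewrite -!shiftM mulVg !shift1.
Qed.

(* A record rather than a pair, so that unification cannot see the product
   structures of the pair through [wr]. *)
Record wreath := Wreath { wflow : G * 'I_r -> int; wbase : G }.

Definition wmul u v :=
  Wreath (wflow u + shift (wbase u) (wflow v))%R (wbase u * wbase v)%g.
Definition winv u := Wreath (- shift (wbase u)^-1%g (wflow u))%R (wbase u)^-1%g.

Fact wmulA u v w : wmul u (wmul v w) = wmul (wmul u v) w.
Proof. by rewrite /wmul /= shiftD shiftM addrA mulgA. Qed.

Fact wmul1 u : wmul (Wreath 0%R 1%g) u = u.
Proof. by case: u => f g; rewrite /wmul /= shift1 add0r mul1g. Qed.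

Fact wmulV u : wmul (winv u) u = Wreath 0%R 1%g.
Proof. by case: u => f g; rewrite /wmul /winv /= addNr mulVg. Qed.

Definition wr : AbsGroup := MkGroup wmulA wmul1 wmulV.

Definition Wr (f : G * 'I_r -> int) (g : G) : wr := Wreath f g.
(** A pair [(b, i)] is read as an edge labelled [i] leaving [b] in a Cayley graph. For the image of
    a word, the flow is the net number of passages of its path through that edge, the coefficient of
    [b] in the [i]-th Fox derivative. *)
Definition flow (u : wr) : G * 'I_r -> int := wflow u.
Definition base (u : wr) : G := wbase u.

Lemma wr_eqP (u v : wr) : flow u = flow v -> base u = base v -> u = v.
Proof. by case: u v => f g [f' g'] /= -> ->. Qed.

Lemma flow_Wr f g : flow (Wr f g) = f. Proof. by []. Qed.
Lemma flow1 p : flow 1%g p = 0%R. Proof. by []. Qed.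
Lemma baseM (u v : wr) : base (u * v)%g = (base u * base v)%g. Proof. by []. Qed.

Lemma flowM (u v : wr) : flow (u * v)%g = (flow u + shift (base u) (flow v))%R.
Proof. by []. Qed.

Lemma flowV (u : wr) : flow u^-1%g = (- shift (base u)^-1%g (flow u))%R.
Proof. by []. Qed.

Lemma baseX (u : wr) n : base (u ^+ n)%g = (base u ^+ n)%g.
Proof. by elim: n => [//|n IH]; rewrite !expgS baseM IH. Qed.

Lemma flowX (u : wr) n : base u = 1%g -> flow (u ^+ n)%g = (flow u *+ n)%R.
Proof.
by move=> u1; elim: n => [//|n IH]; rewrite expgS mulrS -IH flowM u1 shift1.
Qed.

End Wreath.
(* Otherwise [/=] replaces [wr G r] by the bare record, which carries no
   canonical structure. *)
Arguments wr : simpl never.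
Arguments gcarrier : simpl never.

Definition trivial_group : AbsGroup :=
  @MkGroup unit (fun _ _ => tt) (fun _ => tt) tt
    (fun _ _ _ => erefl) (fun x => match x with tt => erefl end) (fun _ => erefl).

Fixpoint magnus (r k : nat) : AbsGroup :=
  if k is k'.+1 then wr (magnus r k') r else trivial_group.

Definition torsion_free (G : groupType) :=
  forall (u : G) n, (u ^+ n.+1 = 1)%g -> u = 1%g.

Definition bounded_roots (G : groupType) :=
  forall e : G, e <> 1%g -> exists N, forall n (u : G), N <= n -> (u ^+ n.+1)%g <> e.

Definition unique_product (G : groupType) :=
  forall X Y : seq G, X != [::] -> Y != [::] ->
  exists x y, [/\ x \in X, y \in Y &
    forall x' y', x' \in X -> y' \in Y -> (x' * y' = x * y)%g -> x' = x /\ y' = y].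

(** The Folner condition for right translations, with tolerance [1 / m] so that all counting stays
    in [nat]. *)
Definition folner (G : groupType) :=
  forall (K : seq G) (m : nat), exists F : seq G,
  [/\ uniq F, F != [::] &
    forall k, k \in K -> m * count (fun u => (u * k)%g \notin F) F <= size F].

Lemma torsion_free_wr (G : AbsGroup) r : torsion_free G -> torsion_free (wr G r).
Proof.
move=> tfG u n un; have u2: base u = 1%g by apply: (tfG _ n); rewrite -baseX un.
apply: wr_eqP => //; apply/funext => p.
have /(congr1 (fun h => h p)) : (flow u *+ n.+1 = 0)%R by rewrite -flowX // un.
by rewrite natmulfctE /= => /eqP; rewrite mulrn_eq0 /= => /eqP.
Qed.

(** A root of an element of the kernel of [base] lies in that kernel by torsion-freeness; there the
    exponent divides every coordinate, so one nonzero coordinate bounds it. *)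
Lemma bounded_roots_wr (G : AbsGroup) r :
  torsion_free G -> bounded_roots G -> bounded_roots (wr G r).
Proof.
move=> tfG brG e e1; have [g1|/eqP/brG[N HN]] := eqVneq (base e) 1%g; last first.
  by exists N => n u leNn /(congr1 (@base _ _)); rewrite baseX; apply: HN.
have [p ep] : exists p, flow e p <> 0%R.
  apply: contrapT => H; apply: e1; apply: wr_eqP => //; apply/funext => p.
  by apply: contrapT => ep; apply: H; exists p.
exists `|flow e p|%N => n u le_n un.
have u2: base u = 1%g by apply: (tfG _ n); rewrite -baseX un.
have: (flow u *+ n.+1 = flow e)%R by rewrite -flowX // un.
move=> /(congr1 (fun h => h p)); rewrite natmulfctE /=.
move=> ab; move: ep le_n; rewrite -{}ab -mulr_natr natz abszM.
by move: (flow u p) => a; case: (eqVneq a 0%R) => [->|]; rewrite ?mul0r //= -absz_gt0; nia.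
Qed.

Lemma torsion_free_magnus r k : torsion_free (magnus r k).
Proof. by elim: k => [[]//|k IH]; apply: torsion_free_wr. Qed.

Lemma bounded_roots_magnus r k : bounded_roots (magnus r k).
Proof.
elim: k => [[]//|k IH]; apply: bounded_roots_wr => //; exact: torsion_free_magnus.
Qed.

(** * Unique products *)

Section UniqueProduct.

Lemma seq_max (T : eqType) (h : T -> int) (X : seq T) : X != [::] ->
  exists2 x, x \in X & forall y, y \in X -> (h y <= h x)%R.
Proof.
elim: X => // x [|z X] IH _.
  by exists x; rewrite ?inE // => y; rewrite inE => /eqP->.
have [//|t tX tmax] := IH; have [le_tx|lt_xt] := lerP (h t) (h x).
  exists x; rewrite ?mem_head // => y; rewrite in_cons => /orP[/eqP->//|/tmax].
  by move/le_trans; apply.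
exists t; rewrite 1?in_cons ?tX ?orbT // => y; rewrite in_cons => /orP[/eqP->|/tmax//].
exact: ltW.
Qed.

(** Induction on the total size. At a coordinate where one of the lists is not constant, keep the
    elements of maximal value in both lists: a sum attaining the sum of the maxima has both summands
    maximal. *)
Lemma unique_sum_fun (P : Type) (X Y : seq (P -> int)) :
  X != [::] -> Y != [::] ->
  exists x y, [/\ x \in X, y \in Y & forall x' y', x' \in X -> y' \in Y ->
    (x' + y' = x + y)%R -> x' = x /\ y' = y].
Proof.
have [n] := ubnP (size X + size Y); elim: n X Y => // n IH X Y ltXYn X0 Y0.
have [[p Hp]|H] := pselect (exists p, exists Z z z',
    [/\ Z = X \/ Z = Y, z \in Z, z' \in Z & z p <> z' p]); last first.
  have constant Z : Z = X \/ Z = Y -> forall z z', z \in Z -> z' \in Z -> z = z'.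
    move=> ZXY z z' zZ z'Z; apply/funext => p; apply: contrapT => zz'; apply: H.
    by exists p, Z, z, z'.
  case: X Y X0 Y0 {IH ltXYn H} constant => // x X [//|y Y] _ _ constant.
  exists x, y; rewrite !mem_head; split=> // x' y' x'X y'Y _.
  by split; [apply: (constant (x :: X)); auto; rewrite mem_head
            |apply: (constant (y :: Y)); auto; rewrite mem_head].
have [x0 x0X x0max] := seq_max (fun f : P -> int => f p) X0.
have [y0 y0Y y0max] := seq_max (fun f : P -> int => f p) Y0.
pose X1 := [seq x <- X | x p == x0 p]; pose Y1 := [seq y <- Y | y p == y0 p].
have x0X1 : x0 \in X1 by rewrite mem_filter eqxx.
have y0Y1 : y0 \in Y1 by rewrite mem_filter eqxx.
have sz (Z : seq (P -> int)) (z0 : P -> int) z z' :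
    z \in Z -> z' \in Z -> z p <> z' p -> size [seq w <- Z | w p == z0 p] < size Z.
  move=> zZ z'Z zz'; rewrite size_filter ltn_neqAle count_size andbT -all_count.
  by apply/negP => /allP H; apply: zz'; rewrite (eqP (H z zZ)) (eqP (H z' z'Z)).
have ltX1Y1 : size X1 + size Y1 < n.
  have leX : size X1 <= size X by rewrite size_filter count_size.
  have leY : size Y1 <= size Y by rewrite size_filter count_size.
  case: Hp => Z [z [z' [[->|->] zZ z'Z zz']]].
    by have := sz X x0 z z' zZ z'Z zz'; rewrite -/X1; lia.
  by have := sz Y y0 z z' zZ z'Z zz'; rewrite -/Y1; lia.
have X10 : X1 != [::] by case: (X1) x0X1.
have Y10 : Y1 != [::] by case: (Y1) y0Y1.
have [x [y [xX1 yY1 U]]] := IH _ _ ltX1Y1 X10 Y10.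
exists x, y; move: (xX1) (yY1); rewrite !mem_filter.
case/andP=> /eqP xp xX /andP[/eqP yp yY]; split=> // x' y' x'X y'Y E.
have Ep : (x' p + y' p = x0 p + y0 p)%R.
  by rewrite -xp -yp; exact: (congr1 (fun h => h p) E).
have x'x := x0max _ x'X; have y'y := y0max _ y'Y.
have [x'p y'p] : x' p = x0 p /\ y' p = y0 p.
  move: (x' p) (y' p) (x0 p) (y0 p) Ep x'x y'y; clear=> a b c e; lia.
by apply: U E; rewrite mem_filter ?x'p ?y'p ?eqxx.
Qed.

(** First take a unique product of bases; over it, products of the two fibres become sums of flows
    after translation by [g], and [unique_sum_fun] applies. *)
Lemma unique_product_wr (G : AbsGroup) r :
  unique_product G -> unique_product (wr G r).
Proof.
move=> upG X Y X0 Y0.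
have nnil (T T' : eqType) (f : T -> T') (Z : seq T) : Z != [::] -> map f Z != [::].
  by case: Z.
have [g [h [/mapP[x xX xg] /mapP[y yY yh] U]]] :=
  upG _ _ (nnil _ _ (@base _ _) _ X0) (nnil _ _ (@base _ _) _ Y0).
pose X1 := [seq flow x | x <- X & base x == g].
pose Y1 := [seq shift g (flow y) | y <- Y & base y == h].
have xX1 : flow x \in X1 by apply/mapP; exists x; rewrite // mem_filter -xg eqxx.
have yY1 : shift g (flow y) \in Y1.
  by apply/mapP; exists y; rewrite // mem_filter -yh eqxx.
have [||s [t [/mapP[x1 + sx1] /mapP[y1 + ty1] U1]]] := @unique_sum_fun _ X1 Y1.
- by case: (X1) xX1.
- by case: (Y1) yY1.
rewrite !mem_filter => /andP[/eqP x1g x1X] /andP[/eqP y1h y1Y].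
exists x1, y1; split=> // x' y' x'X y'Y E.
have E1 := congr1 (@flow _ _) E; have E2 := congr1 (@base _ _) E.
rewrite !flowM in E1; rewrite !baseM in E2.
have [|x'g y'h] := U _ _ (map_f (@base _ _) x'X) (map_f (@base _ _) y'Y).
  by rewrite E2 x1g y1h.
rewrite x'g x1g in E1; have [|||E3 E4] := U1 (flow x') (shift g (flow y')) _ _.
- by apply/mapP; exists x'; rewrite // mem_filter x'g eqxx.
- by apply/mapP; exists y'; rewrite // mem_filter y'h eqxx.
- by rewrite E1 sx1 ty1.
move: E3 E4; rewrite sx1 ty1 => E3 /shift_inj E4.
by split; apply: wr_eqP; rewrite // ?x'g ?y'h.
Qed.

Lemma unique_product_magnus r k : unique_product (magnus r k).
Proof.
elim: k => [|k IH]; last exact: unique_product_wr.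
move=> [//|x X] [//|y Y] _ _; exists x, y; rewrite !mem_head; split=> // x' y' _ _ _.
by case: x x' y y' => [] [] [] [].
Qed.

(** If [f] were nonzero, the coefficient of the convolution at a unique product of the two supports
    would be a single nonzero term. *)
Lemma conv_eq0 (G : AbsGroup) (F K : seq G) (y f : G -> int) : unique_product G ->
  uniq F -> (exists2 u, u \in F & y u <> 0%R) -> (forall b, f b <> 0%R -> b \in K) ->
  (forall b, \sum_(u <- F) y u * f (u^-1 * b)%g = 0)%R -> forall b, f b = 0%R.
Proof.
move=> upG uF [u0 u0F yu0] fK conv b0; apply: contrapT => fb0.
pose X := [seq u <- F | y u != 0%R]; pose Y := [seq b <- K | f b != 0%R].
have [||x [z [+ + U]]] := upG X Y.
- by have : u0 \in X; [rewrite mem_filter u0F andbT; apply/eqP|case: (X)].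
- by have : b0 \in Y; [rewrite mem_filter fK // andbT; apply/eqP|case: (Y)].
rewrite !mem_filter => /andP[yx xF] /andP[fz zK].
have := conv (x * z)%g; rewrite (bigD1_seq x) //= big1_seq => [|u /andP[ux uF']].
  by rewrite addr0 mulKg => /eqP; rewrite mulf_eq0 (negPf yx) (negPf fz).
apply/eqP; apply: contraR ux; rewrite mulf_eq0 negb_or => /andP[yu fu].
apply/eqP; have [] // := U u (u^-1 * (x * z))%g.
- by rewrite mem_filter yu.
- by rewrite mem_filter fu fK //; apply/eqP.
- by rewrite mulVKg.
Qed.

End UniqueProduct.

(** * Folner sets and the strong rank condition *)

Section Folner.

(** Bernoulli's inequality [(1 + 1/m)^j >= 1 + j/m] with denominators cleared. *)
Lemma bernoulli_nat m j : m ^ j * (m + j) <= m * m.+1 ^ j.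
Proof.
elim: j => [|j IH]; first by rewrite !expn0 mul1n muln1 addn0.
have: m ^ j * (m + j) * m.+1 <= m * m.+1 ^ j * m.+1 by rewrite leq_mul2r IH orbT.
rewrite !expnS; move: (m ^ j) (m.+1 ^ j) => a b; nia.
Qed.

Lemma exp_beats_poly m k : 0 < m -> exists n, m ^ n * n.+1 ^ k < m.+1 ^ n.
Proof.
move=> m0; have double : m ^ m * 2 <= m.+1 ^ m.
  by have := bernoulli_nat m m; move: (m ^ m) (m.+1 ^ m) => a b; nia.
have pow2 t : 4 <= t -> 3 * t <= 2 ^ t.
  elim: t => // t IH; case: (ltnP t 4) => [|/IH]; last by rewrite expnS; lia.
  by case: t {IH} => [|[|[|[|]]]].
(* With [n = m * q], the ratio [((m + 1) / m) ^ n] is at least [2 ^ q], while [(n + 1) ^ k] is at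
   most [2 ^ ((m + 2 t) k)]; the choice makes [(m + 2 t) k < 2 ^ t * 2 ^ t = q]. *)
pose t := m + k + 4; pose q := 2 ^ (2 * t).
have q0 : 0 < q by rewrite expn_gt0.
exists (m * q); rewrite !expnM.
have le1 : (m ^ m) ^ q * 2 ^ q <= (m.+1 ^ m) ^ q by rewrite -expnMn leq_exp2r.
apply: leq_trans le1; rewrite ltn_pmul2l; last by rewrite !expn_gt0 m0.
have mqle : (m * q).+1 <= 2 ^ (m + 2 * t).
  by rewrite expnD -/q; have := ltn_expl m (isT : 1 < 2); nia.
have [->|k0] := posnP k; first by rewrite expn0 -(expn0 2) ltn_exp2l.
apply: (@leq_ltn_trans ((2 ^ (m + 2 * t)) ^ k)); first by rewrite leq_exp2r.
rewrite -expnM ltn_exp2l // /q mulnC.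
have kt : k < 2 ^ t by apply: leq_ltn_trans (ltn_expl t (isT : 1 < 2)); rewrite /t; lia.
have := pow2 t; rewrite mul2n -addnn expnD; have : m < t by rewrite /t; lia.
by have : 4 <= t by [rewrite /t; lia]; move: (2 ^ t) kt => a; nia.
Qed.

Variable V : zmodType.
Implicit Types (K : seq V) (u : V).

Fixpoint box K n : seq V :=
  if n is n'.+1 then
    undup (box K n' ++ [seq (u + k)%R | u <- box K n', k <- K])
  else [:: 0%R].

Lemma box_uniq K n : uniq (box K n).
Proof. by case: n => //= n; apply: undup_uniq. Qed.

Lemma box_sub K n : {subset box K n <= box K n.+1}.
Proof. by move=> u un; rewrite /= mem_undup mem_cat un. Qed.

Lemma box_add K n u k : u \in box K n -> k \in K -> (u + k)%R \in box K n.+1.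
Proof.
move=> un kK; rewrite /= mem_undup mem_cat; apply/orP; right.
by apply/allpairsP; exists (u, k).
Qed.

Lemma box_coord K n u : u \in box K n -> exists c : 'I_(size K) -> nat,
  (forall i, c i <= n) /\ u = (\sum_(i < size K) K`_i *+ c i)%R.
Proof.
elim: n u => [|n IH] u /=.
  rewrite inE => /eqP->; exists (fun _ => 0); split=> //.
  by rewrite big1 // => i _; rewrite mulr0n.
rewrite mem_undup mem_cat => /orP[/IH[c [cn ->]]|].
  by exists c; split=> // i; apply: leqW.
case/allpairsP=> -[v k] /= [/IH[c [cn ->]] kK ->].
pose j : 'I_(size K) := Ordinal (etrans (index_mem k K) kK).
exists (fun i => c i + (i == j)); split=> [i|]; first by have := cn i; case: eqP; lia.
under [RHS]eq_bigr do rewrite mulrnDr; rewrite big_split /=; congr (_ + _)%R.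
rewrite (bigD1 j) //= eqxx mulr1n nth_index // big1 ?addr0 // => i /negPf->.
by rewrite mulr0n.
Qed.

Lemma box_size K n : size (box K n) <= n.+1 ^ size K.
Proof.
have <- : #|{ffun 'I_(size K) -> 'I_n.+1}| = n.+1 ^ size K by rewrite card_ffun !card_ord.
rewrite cardE -(size_map (fun c : {ffun 'I_(size K) -> 'I_n.+1} =>
  \sum_(i < size K) K`_i *+ c i)%R).
apply: uniq_leq_size (box_uniq K n) _ => u /box_coord[c [cn ->]].
apply/mapP; exists [ffun i => inord (c i)]; rewrite ?mem_enum //.
by apply: eq_bigr => i _; rewrite ffunE inordK // ltnS.
Qed.

(* The boxes grow polynomially, hence not by a factor 1 + 1/m at every step. *)
Lemma folner_zmod K m : exists F : seq V, [/\ uniq F, F != [::] &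
  forall k, k \in K -> m * count (fun u => (u + k)%R \notin F) F <= size F].
Proof.
have [->|m0] := posnP m; first by exists [:: 0%R].
suff [n Hn] : exists n, m * (size (box K n.+1) - size (box K n)) <= size (box K n).
  exists (box K n); split=> [||k kK]; first exact: box_uniq.
    have : 0%R \in box K n by elim: n {Hn} => [|n /box_sub//]; rewrite mem_head.
    by case: (box K n).
  apply: leq_trans Hn; rewrite leq_mul2l -(count_predC (mem (box K n)) (box K n.+1)).
  have -> : count (mem (box K n)) (box K n.+1) = size (box K n).
    rewrite -size_filter; apply/perm_size/uniq_perm; rewrite ?filter_uniq ?box_uniq //.
    by move=> u; rewrite mem_filter andb_idr //; apply: box_sub.
  rewrite addKn -!size_filter -(size_map (fun u => u + k)%R); apply/orP; right.
  apply: uniq_leq_size => [|u].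
    by rewrite map_inj_uniq ?filter_uniq ?box_uniq //; apply: addIr.
  by case/mapP=> v; rewrite !mem_filter => /andP[vk vn] ->; rewrite /= vk box_add.
apply: contrapT => H; have [n] := exp_beats_poly (size K) m0; apply/negP; rewrite -leqNgt.
suff : m.+1 ^ n <= m ^ n * size (box K n).
  by move/leq_trans; apply; rewrite leq_mul2l box_size orbT.
elim: n => // n IH; have : ~ m * (size (box K n.+1) - size (box K n)) <= size (box K n).
  by move=> Hn; apply: H; exists n.
move: IH; rewrite !expnS; move: (m.+1 ^ n) (m ^ n) (size (box K n)) (size _).
by move=> a b s t; nia.
Qed.

End Folner.

Lemma sum_nat_of_bool (T : Type) (s : seq T) (a : pred T) :
  \sum_(x <- s) (a x : nat) = count a s.
Proof. by rewrite -sum1_count [RHS]big_mkcond; apply: eq_bigr => x _; case: (a x). Qed.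

(** The Folner set is a product: first [T] for the bases, then [C] for the translates by [T] of the
    flows in [K]. An element can leave it through either factor, hence the tolerance [2 * m] for
    each. *)
Lemma folner_wr (G : AbsGroup) r : folner G -> folner (wr G r).
Proof.
move=> fG K m.
have [T [uT T0 HT]] := fG [seq base k | k <- K] (2 * m).
have [C [uC C0 HC]] := folner_zmod [seq shift t (flow k) | k <- K, t <- T] (2 * m).
exists [seq Wr s t | s <- C, t <- T]; split.
- by rewrite allpairs_uniq // => -[s t] [s' t'] _ _ [-> ->].
- by case: C T C0 T0 {uT uC HT HC} => [|s C] [|t T].
move=> k kK; rewrite size_allpairs.
set E := [seq _ | _ <- C, _ <- T].
have memE s t : (Wr s t \in E) = (s \in C) && (t \in T).
  apply/allpairsP/andP => [[[s' t'] /= [sC tT [-> ->]]]//|[sC tT]].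
  by exists (s, t).
have E1 : count (fun u => (u * k)%g \notin E) E <=
   \sum_(s <- C) \sum_(t <- T) ((t * base k)%g \notin T) +
   \sum_(s <- C) \sum_(t <- T) ((s + shift t (flow k))%R \notin C).
  rewrite -sum1_count big_mkcond big_allpairs_dep /= -big_split /=.
  apply: leq_sum => s _; rewrite -big_split; apply: leq_sum => t _ /=.
  have -> : (Wr s t * k)%g = Wr (s + shift t (flow k))%R (t * base k)%g by [].
  by rewrite memE negb_and; case: (_ \in C); case: (_ \in T).
have E2 : 2 * m * (\sum_(s <- C) \sum_(t <- T) ((t * base k)%g \notin T)) <= size C * size T.
  rewrite big_const_seq iter_addn_0 count_predT mulnA mulnC leq_mul2l.
  by rewrite sum_nat_of_bool HT ?orbT // map_f.
have E3 : 2 * m * (\sum_(s <- C) \sum_(t <- T) ((s + shift t (flow k))%R \notin C))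
    <= size C * size T.
  rewrite exchange_big /= big_distrr /= [leqRHS]mulnC -(sum1_size T) big_distrl /=.
  rewrite big_seq [leqRHS]big_seq; apply: leq_sum => t tT; rewrite mul1n sum_nat_of_bool.
  by apply: HC; apply/allpairsP; exists (k, t).
rewrite -(leq_pmul2l (isT : 0 < 2)) mulnA.
apply: leq_trans (leq_mul (leqnn _) E1) _.
by rewrite mulnDr [leqRHS]mul2n -addnn leq_add.
Qed.

Lemma folner_magnus r k : folner (magnus r k).
Proof.
elim: k => [|k IH]; last exact: folner_wr.
move=> K m; exists [:: 1%g]; split=> // k _.
have all_eq (u v : magnus r 0) : u = v by case: u; case: v.
rewrite (@eq_count _ _ pred0) ?count_pred0 ?muln0 // => u.
by rewrite (all_eq (u * k)%g 1%g) mem_head.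
Qed.

Section StrongRank.

Lemma int_kernel (I J : finType) (a : I -> J -> int) : #|J| < #|I| ->
  exists k : I -> int, (exists i, k i <> 0%R) /\ forall j, (\sum_i k i * a i j = 0)%R.
Proof.
move=> ltJI; pose M := (\matrix_(i < #|I|, j < #|J|) a (enum_val i) (enum_val j))%R.
have [L uL [R uR [d _ defM]]] := int_Smith_normal_form M.
(* Row [i0] lies beyond the last column index, so the diagonal matrix vanishes on it, and row [i0]
   of the inverse of [L] annihilates [M]. *)
pose i0 : 'I_#|I| := Ordinal ltJI.
exists (fun i => invmx L i0 (enum_rank i)); split.
  apply: contrapT => H; have := mulVmx uL; move/matrixP/(_ i0 i0).
  rewrite !mxE eqxx big1 // => i _; apply/eqP; rewrite mulf_eq0; apply/orP; left.
  by apply/eqP; apply: contrapT => Hi; apply: H; exists (enum_val i); rewrite enum_valK.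
move=> j; have /matrixP/(_ i0 (enum_rank j)) : (invmx L *m M)%R =
    ((\matrix_(i, j) (d`_i *+ (i == j :> nat))) *m R)%R.
  by rewrite defM -mulmxA mulKmx.
rewrite !mxE [RHS]big1 => [E|i _]; last first.
  by rewrite mxE /= gtn_eqF ?ltn_ord // mulr0n mul0r.
rewrite -[RHS]E (reindex (@enum_val I predT)) /=; last exact/onW_bij/enum_val_bij.
by apply: eq_bigr => i _; rewrite mxE enum_valK enum_rankK.
Qed.

(* Fewer equations than unknowns: the coefficients are sought in a Folner set [F]
   so large that its enlargement [F'] satisfies n |F'| < (n + 1) |F|. *)
Lemma strong_rank (G : AbsGroup) n (a : 'I_n.+1 -> 'I_n -> G -> int) (K : seq G) :
  folner G -> (forall i j b, a i j b <> 0%R -> b \in K) ->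
  exists (F : seq G) (k : 'I_n.+1 -> G -> int),
  [/\ uniq F, exists i, exists2 u, u \in F & k i u <> 0%R &
    forall j b, (\sum_(u <- F) \sum_i k i u * a i j (u^-1 * b)%g = 0)%R].
Proof.
(* With this tolerance [|F'| <= |F| + |K| |F| / (n |K| + 1)], which gives [n |F'| < (n + 1) |F|]. *)
move=> fG aK; have [F [uF F0 HF]] := fG K (n * size K).+1.
pose F' := undup (F ++ [seq (u * k)%g | u <- F, k <- K]).
have szF' : n * size F' < n.+1 * size F.
  have : (n * size K).+1 * size F' <= (n * size K).+1 * size F + size K * size F.
    have : size F' <= size F + \sum_(k <- K) count (fun u => (u * k)%g \notin F) F.
      have -> : \sum_(k <- K) count (fun u => (u * k)%g \notin F) F =
          size (flatten [seq [seq (u * k)%g | u <- F & (u * k)%g \notin F] | k <- K]).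
        rewrite size_flatten /shape -map_comp sumnE big_map; apply: eq_bigr => k _.
        by rewrite /= size_map size_filter.
      rewrite -size_cat; apply: uniq_leq_size; first exact: undup_uniq.
      move=> b; rewrite mem_undup !mem_cat => /orP[->//|/allpairsP[[u k] /= [uF' kK ->]]].
      case: (boolP (u * k \in F)%g) => //= ukF; apply/flattenP.
      exists [seq (u * k)%g | u <- F & (u * k)%g \notin F]; first exact: map_f.
      by apply: map_f; rewrite mem_filter ukF.
    move/(leq_mul (leqnn (n * size K).+1))/leq_trans; apply.
    rewrite mulnDr leq_add2l big_distrr /= -[X in _ <= X * _](sum1_size K) big_distrl /=.
    rewrite big_seq [leqRHS]big_seq.
    by apply: leq_sum => k kK; rewrite mul1n; apply: HF.
  have : 0 < size F by case: (F) F0.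
  move: (size K) (size F) (size F') => x y z.
  case: (posnP n) => [->|n0]; first by lia.
  move=> y0; case: (posnP x) => [->|x0]; first by nia.
  by move=> H; rewrite ltnNge; apply/negP => H'; nia.
pose aa (p : 'I_n.+1 * 'I_(size F)) (q : 'I_n * 'I_(size F')) :=
  a p.1 q.1 ((nth 1 F p.2)^-1 * nth 1 F' q.2)%g.
have [|k [[[i s] kis] Hk]] := int_kernel aa; first by rewrite !card_prod !card_ord.
pose kk i u : int := if insub (index u F) is Some s then k (i, s) else 0%R.
have kkE i' (s' : 'I_(size F)) : kk i' (nth 1%g F s') = k (i', s').
  by rewrite /kk index_uniq // valK.
exists F, kk; split=> //.
  by exists i, (nth 1%g F s); rewrite ?kkE ?mem_nth.
move=> j b; case: (boolP (b \in F')) => [bF'|bF']; last first.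
  rewrite big_seq big1 // => u uF1; rewrite big1 // => i' _.
  apply/eqP; rewrite mulf_eq0; apply/orP; right; apply: contraR bF' => /eqP/aK ubK.
  rewrite mem_undup mem_cat; apply/orP; right; apply/allpairsP.
  by exists (u, u^-1 * b)%g; rewrite mulVKg.
rewrite -[RHS](Hk (j, Ordinal (etrans (index_mem b F') bF'))) (big_nth 1%g) big_mkord.
rewrite exchange_big pair_big /=.
apply: eq_bigr => -[i' s'] _ /=.
by rewrite kkE /aa /= nth_index.
Qed.

End StrongRank.

(** * Moments of finitely supported functions *)

Section WeightedLists.
Local Open Scope ring_scope.

(** A list of weighted points stands for an element of the free abelian group on [P], repetitions
    allowed, and [wsum l] evaluates linear extensions on it. Indicator functions read off
    coefficients. *)
Definition wsum (P : Type) (l : seq (int * P)) (h : P -> int) : int :=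
  \sum_(c <- l) c.1 * h c.2.

Lemma wsum_cat (P : Type) (l l' : seq (int * P)) h :
  wsum (l ++ l') h = wsum l h + wsum l' h.
Proof. exact: big_cat. Qed.

Lemma wsum_map (P Q : Type) (f : P -> Q) (l : seq (int * P)) h :
  wsum [seq (c.1, f c.2) | c <- l] h = wsum l (h \o f).
Proof. by rewrite /wsum big_map. Qed.

Lemma eq_wsum (P : Type) (l : seq (int * P)) h h' : h =1 h' -> wsum l h = wsum l h'.
Proof. by move=> E; apply: eq_bigr => c _; rewrite E. Qed.

Lemma wsum_ext (P : eqType) (l l' : seq (int * P)) h :
  (forall p, wsum l (fun q => (q == p)%:R) = wsum l' (fun q => (q == p)%:R)) ->
  wsum l h = wsum l' h.
Proof.
move=> E; pose U := undup [seq c.2 | c <- l ++ l'].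
have wsumE k : {subset k <= l ++ l'} ->
    wsum k h = \sum_(p <- U) wsum k (fun q => (q == p)%:R) * h p.
  move=> sub; under [RHS]eq_bigr do rewrite /wsum mulr_suml.
  rewrite exchange_big /= /wsum big_seq [RHS]big_seq; apply: eq_bigr => c ck.
  have cU : c.2 \in U by rewrite mem_undup map_f ?sub.
  rewrite (bigD1_seq c.2) ?undup_uniq //= eqxx mulr1 big1 ?addr0 // => p /negPf.
  by rewrite eq_sym => ->; rewrite mulr0 mul0r.
rewrite !wsumE => [|c cl|c cl]; last 2 first.
- by rewrite mem_cat cl orbT.
- by rewrite mem_cat cl.
by apply: eq_bigr => p _; rewrite E.
Qed.

Lemma wsum_eq0 (P : eqType) (l : seq (int * P)) h :
  (forall p, wsum l (fun q => (q == p)%:R) = 0) -> wsum l h = 0.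
Proof.
move=> E; rewrite (@wsum_ext _ l [::]); first exact: big_nil.
by move=> p; rewrite E /wsum big_nil.
Qed.

End WeightedLists.

Section Moments.
Local Open Scope ring_scope.
Variables (G : AbsGroup) (r : nat).
Notation W := (wr G r).

Section Moment.
Variables (F : seq W) (v : 'I_r -> W -> int).

(** The integral against [v j] of a polynomial in the coordinates of the flow, of degree [size s],
    over the elements of [F] above [q]. The constants in [s] absorb translations. *)
Definition moment (s : seq ((G * 'I_r) * int)) (q : G) (j : 'I_r) : int :=
  \sum_(u <- F) (base u == q)%:R * (\prod_(p <- s) (flow u p.1 - p.2)) * v j u.

(** Changing one constant changes the polynomial by a multiple of one of lower degree, whose moment
    vanishes. The constants are replaced one at a time, and [t] collects the factors already
    treated. *)
Lemma moment_shift n : (forall s q j, (size s < n)%N -> moment s q j = 0) ->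
  forall s s' t q j, (size t + size s = n)%N -> map fst s = map fst s' ->
  moment (t ++ s) q j = moment (t ++ s') q j.
Proof.
move=> small; elim=> [|[p c] s IH] [|[p' c'] s'] //= t q j sz [<- ss'].
rewrite -(cat_rcons (p, c') t s') -(IH s' (rcons t (p, c'))) //;
  last by rewrite size_rcons; lia.
rewrite cat_rcons; apply/eqP; rewrite -subr_eq0 -sumrB.
rewrite (eq_bigr (fun u => (c' - c) * ((base u == q)%:R *
   (\prod_(p <- t ++ s) (flow u p.1 - p.2)) * v j u))) => [|u _].
  by rewrite -mulr_sumr -/(moment _ _ _) small ?mulr0 // size_cat; lia.
rewrite !big_cat !big_cons /=; ring.
Qed.

Lemma moments_eq0 : uniq F -> (forall s q j, moment s q j = 0) ->
  forall j b, b \in F -> v j b = 0.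
Proof.
move=> uF M0 j b0 b0F.
have /choice[f Hf] (b : W) : exists p, flow b <> flow b0 -> flow b p <> flow b0 p.
  have [//|H] := pselect (exists p, flow b p <> flow b0 p).
    by case=> p ?; exists p.
  exists (1%g, j) => E; exfalso; apply: E; apply/funext => p.
  by apply: contrapT => E; apply: H; exists p.
(* Lagrange interpolation: this polynomial vanishes at every point of [F] above [base b0] except
   [b0], so its moment isolates [v j b0]. *)
pose s := [seq (f b, flow b (f b)) | b <- F & (b != b0) && (base b == base b0)].
have := M0 s (base b0) j; rewrite /moment (bigD1_seq b0) //= eqxx mul1r.
rewrite [X in _ + X]big1_seq ?addr0 => [/eqP|u /andP[ub0 uF']]; last first.
  case: (eqVneq (base u) (base b0)) => [Eb|_]; last by rewrite !mul0r.
  have us : (f u, flow u (f u)) \in s.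
    by apply/mapP; exists u => //; rewrite mem_filter ub0 Eb eqxx.
  by rewrite (big_rem _ us) /= subrr mul0r mulr0 mul0r.
rewrite mulf_eq0 => /orP[|/eqP//]; rewrite big_map big_filter prodf_seq_eq0.
case/hasP=> b bF /andP[/andP[bb0 /eqP Eb]]; rewrite subr_eq0 => /eqP E.
exfalso; apply: (Hf b); last by [].
by move=> Ef; move/eqP: bb0; apply; apply: wr_eqP.
Qed.

End Moment.

(* With N the matrix with rows [l], the hypotheses say that v = v N and that N
   dies in Z[G]: the moments of v then vanish by induction on the degree. *)
Lemma augmentation_fixed_eq0 (F : seq W) (v : 'I_r -> W -> int)
    (l : 'I_r -> seq (int * (W * 'I_r))) : uniq F ->
  (forall i q j, wsum (l i) (fun c => ((base c.1, c.2) == (q, j))%:R) = 0) ->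
  (forall j b, (if b \in F then v j b else 0) =
    \sum_(u <- F) \sum_i v i u *
      wsum (l i) (fun c => (((u * c.1)%g, c.2) == (b, j))%:R)) ->
  forall j b, b \in F -> v j b = 0.
Proof.
move=> uF l0 vN; apply: moments_eq0 => // s.
have [n] := ubnP (size s); elim: n s => // n IH s ltsn q j.
have small s' q' j' : (size s' < size s)%N -> moment F v s' q' j' = 0.
  by move=> lts; apply: IH; apply: leq_trans lts _.
pose h (u : W) : int := (base u == q)%:R * (\prod_(p <- s) (flow u p.1 - p.2)).
pose H (p : W * 'I_r) := h p.1 * (p.2 == j)%:R.
pose L1 := [seq (v i u, (u, i)) | u <- F, i <- enum 'I_r].
pose L2 := [seq (v ui.2 ui.1 * c.1, ((ui.1 * c.2.1)%g, c.2.2)) |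
             ui <- [seq (u, i) | u <- F, i <- enum 'I_r], c <- l ui.2].
have L1E g : wsum L1 g = \sum_(u <- F) \sum_i v i u * g (u, i).
  by rewrite /wsum big_allpairs_dep; apply: eq_bigr => u _; rewrite /= big_enum.
have L2E g : wsum L2 g = \sum_(u <- F) \sum_i v i u *
    wsum (l i) (fun c => g ((u * c.1)%g, c.2)).
  rewrite /wsum big_allpairs_dep big_allpairs_dep; apply: eq_bigr => u _ /=.
  rewrite big_enum; apply: eq_bigr => i _ /=; rewrite mulr_sumr.
  by apply: eq_bigr => c _; rewrite mulrA.
have L12 : wsum L1 H = wsum L2 H.
  apply: wsum_ext => -[b i]; rewrite L1E L2E -vN exchange_big /= (bigD1 i) //=.
  rewrite [X in _ + X]big1 ?addr0 => [|i' /negPf ii']; last first.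
    by rewrite big1 // => u _; rewrite xpair_eqE ii' andbF mulr0.
  have E u : v i u * ((u, i) == (b, i))%:R = if u == b then v i b else 0.
    by rewrite xpair_eqE eqxx andbT; case: eqP => [->|_]; rewrite ?mulr1 ?mulr0.
  under eq_bigr do rewrite E.
  case: ifP => bF; last first.
    by rewrite big1_seq // => u /= uF'; case: eqP => // ub; rewrite -ub uF' in bF.
  rewrite (bigD1_seq b) //= eqxx big1 ?addr0 // => u /negPf->//.
transitivity (wsum L1 H).
  rewrite L1E; apply: eq_bigr => u _; rewrite (bigD1 j) //= /H /= eqxx mulr1.
  rewrite [X in _ + X]big1 => [|i /negPf->]; last by rewrite !mulr0.
  by rewrite addr0 mulrC.
rewrite L12 L2E exchange_big big1 // => i _ /=.
(* Right multiplication by [w] translates the flows of the elements above [q1] by one fixed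
   function, so only the constants of the polynomial change, and [moment_shift] removes the effect.
   What is left depends on [w] through its base only, and [l0] makes it vanish. *)
transitivity (wsum (l i) (fun c =>
   (c.2 == j)%:R * moment F v s (q * (base c.1)^-1)%g i)).
  rewrite /wsum; under eq_bigr do rewrite mulr_sumr.
  rewrite exchange_big; apply: eq_bigr => c _ /=.
  set w := c.2.1; set q1 := (q * _)%g.
  pose s' := [seq (p.1, p.2 - shift q1 (flow w) p.1) | p <- s].
  have -> : moment F v s q1 i = moment F v s' q1 i.
    apply: (@moment_shift F v (size s) small s s' [::]) => //.
    by rewrite /s' -map_comp; apply: eq_map.
  rewrite /moment mulrA mulr_sumr; apply: eq_bigr => u _.
  rewrite /H /= /h baseM.
  have -> : ((base u * base w)%g == q) = (base u == q1).
    by rewrite /q1; apply/eqP/eqP => [<-|->]; rewrite ?mulgK ?mulgVK.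
  case: eqP => [Eu|_]; last by rewrite !mul0r !mulr0.
  have -> : \prod_(p <- s) (flow (u * w)%g p.1 - p.2) =
      \prod_(p <- s') (flow u p.1 - p.2).
    rewrite big_map; apply: eq_bigr => p _; rewrite flowM Eu /=.
    rewrite (_ : (flow u + shift q1 (flow w)) p.1 = flow u p.1 + shift q1 (flow w) p.1) //.
    ring.
  ring.
pose f (c : W * 'I_r) := (base c.1, c.2).
rewrite -(@wsum_map _ _ f (l i)
  (fun p => (p.2 == j)%:R * moment F v s (q * p.1^-1)%g i)).
by apply: wsum_eq0 => -[q' j']; rewrite wsum_map; apply: l0.
Qed.

End Moments.

(** * Free solvable groups *)

Section Homs.
Variables (G K : AbsGroup) (f : G -> K).
Hypothesis fM : is_hom f.

Lemma homM x y : f (x * y)%g = (f x * f y)%g. Proof. exact: fM. Qed.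

Lemma hom1 : f 1%g = 1%g.
Proof. by apply: (mulgI (f 1%g)); rewrite -homM !mulg1. Qed.

Lemma homV x : f (x^-1)%g = (f x)^-1%g.
Proof. by apply: (mulgI (f x)); rewrite -homM !mulgV hom1. Qed.

Lemma homX x n : f (x ^+ n)%g = (f x ^+ n)%g.
Proof. by elim: n => [|n IH]; rewrite ?hom1 // !expgS homM IH. Qed.

Lemma hom_gen (A : G -> Prop) (B : K -> Prop) g :
  (forall a, A a -> gen B (f a)) -> gen A g -> gen B (f g).
Proof.
move=> AB; elim=> [a /AB//||a b _ IHa _ IHb|a _ IHa].
- by rewrite hom1; apply: gen_one.
- by rewrite homM; apply: gen_mul.
- by rewrite homV; apply: gen_inv.
Qed.

Lemma hom_derived k g : derived k g -> derived k (f g).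
Proof.
elim: k g => // k IH g; apply: hom_gen => _ [a [b [/IH fa [/IH fb ->]]]].
apply: gen_base; exists (f a), (f b); split=> //; split=> //.
by rewrite /Defs.commg !fM !(homV _ : f (ginv _) = _).
Qed.

End Homs.

Lemma hom_ext (G K : AbsGroup) r (x : 'I_r -> G) (f f' : G -> K) :
  (forall g, gen (fun y => exists i, y = x i) g) -> is_hom f -> is_hom f' ->
  (forall i, f (x i) = f' (x i)) -> f =1 f'.
Proof.
move=> genx fM f'M E g; elim: (genx g) => [_ [i ->]//||a b _ IHa _ IHb|a _ IHa].
- by rewrite (hom1 fM) (hom1 f'M).
- by rewrite fM f'M IHa IHb.
- by rewrite (homV fM) (homV f'M) IHa.
Qed.

Lemma hom_comp (G K L : AbsGroup) (f : G -> K) (h : K -> L) :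
  is_hom f -> is_hom h -> is_hom (h \o f).
Proof. by move=> fM hM a b; rewrite /= fM hM. Qed.

Section Derived.
Variable G : AbsGroup.
Implicit Types (g h : G) (k : nat).

Lemma derived1 k : derived k (1%g : G).
Proof. by case: k => //= k; apply: gen_one. Qed.

Lemma derivedM k g h : derived k g -> derived k h -> derived k (g * h)%g.
Proof. by case: k => //= k; apply: gen_mul. Qed.

Lemma derivedV k g : derived k g -> derived k (g^-1)%g.
Proof. by case: k => //= k; apply: gen_inv. Qed.

Lemma derivedJ k g h : derived k g -> derived k (h * g * h^-1)%g.
Proof.
apply: (@hom_derived _ _ (fun a => h * a * h^-1)%g) => a b.
by rewrite -[gmul a b]/(a * b)%g -[gmul _ _]/(_ * _)%g !mulgA mulgVK.
Qed.

Lemma derived_comm k g h : derived k g -> derived k h ->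
  derived k.+1 (g * h * g^-1 * h^-1)%g.
Proof.
move=> dg dh; apply: gen_base; exists (g^-1)%g, (h^-1)%g.
split; [exact: derivedV|split; [exact: derivedV|]].
by rewrite -[RHS]/((g^-1^-1 * h^-1^-1) * (g^-1 * h^-1))%g !invgK !mulgA.
Qed.

Lemma derivedS k g : derived k.+1 g -> derived k g.
Proof.
elim=> [_ [a [b [da [db ->]]]]||a b _ da _ db|a _ da].
- by apply: derivedM; apply: derivedM => //; apply: derivedV.
- exact: derived1.
- exact: derivedM.
- exact: derivedV.
Qed.

Lemma derived_leq k m g : k <= m -> derived m g -> derived k g.
Proof.
by move/subnK <-; elim: (m - k) => // n IH /derivedS.
Qed.

End Derived.

Lemma derived_magnus r k (g : magnus r k) : derived k g -> g = 1%g.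
Proof.
elim: k g => [[]//|k IH] g; have dg (a : magnus r k.+1) : derived k a -> base a = 1%g.
  by move=> da; apply: IH; apply: hom_derived da.
elim=> [_ [a [b [da [db ->]]]]|//|a b _ -> _ ->|a _ ->]; last 2 first.
- exact: mulg1.
- exact: invg1.
rewrite -[LHS]/((a^-1 * b^-1) * (a * b))%g; have -> : (a * b = b * a)%g.
  by apply: wr_eqP; rewrite ?baseM ?flowM !(dg a) ?(dg b) // !shift1 addrC.
by rewrite !mulgA mulgVK mulVg.
Qed.

Fixpoint magnus_gen r k (i : 'I_r) : magnus r k :=
  if k is k'.+1 then Wr (fun p => (p == (1%g, i))%:R%R) (magnus_gen k' i)
  else 1%g.

Lemma gen_word (G : AbsGroup) r (x : 'I_r -> G) g :
  gen (fun y => exists i, y = x i) g -> exists w : word r, weval x w = g.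
Proof.
elim=> [_ [i ->]||a b _ [wa <-] _ [wb <-]|a _ [wa <-]].
- by exists (wVar i).
- by exists (wOne r).
- by exists (wMul wa wb).
- by exists (wInv wa).
Qed.

Lemma hom_weval (G K : AbsGroup) (f : G -> K) n (xs : 'I_n -> G) (w : word n) :
  is_hom f -> f (weval xs w) = weval (f \o xs) w.
Proof.
move=> fM; elim: w => //= [|u <- v <-|u <-]; first exact: (hom1 fM).
  exact: fM.
exact: (homV fM).
Qed.

Section SubgroupGroup.
Variables (G : AbsGroup) (H : G -> Prop).
Hypothesis sH : is_subgroup H.

Let sub_mul (u v : {g : G | H g}) : {g : G | H g} :=
  exist _ (sval u * sval v)%g (sH.2.1 _ _ (svalP u) (svalP v)).
Let sub_inv (u : {g : G | H g}) : {g : G | H g} :=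
  exist _ (sval u)^-1%g (sH.2.2 _ (svalP u)).

Fact sub_mulA u v w : sub_mul u (sub_mul v w) = sub_mul (sub_mul u v) w.
Proof. by apply: eq_exist; apply: mulgA. Qed.
Fact sub_mul1 u : sub_mul (exist _ 1%g sH.1) u = u.
Proof. by case: u => g Hg; apply: eq_exist; apply: mul1g. Qed.
Fact sub_mulV u : sub_mul (sub_inv u) u = exist _ 1%g sH.1.
Proof. by apply: eq_exist; apply: mulVg. Qed.

Definition subgroup : AbsGroup := MkGroup sub_mulA sub_mul1 sub_mulV.

End SubgroupGroup.

Section FreeSolvable.
Variables (r d : nat) (S : AbsGroup) (x : 'I_r -> S).
Hypothesis freeS : is_free_solvable d x.

(** The universal property yields a homomorphism to the subgroup generated by the basis; followed by
    the inclusion it fixes the basis, so it is the identity by uniqueness. *)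
Lemma free_solvable_gen g : gen (fun y => exists i, y = x i) g.
Proof.
have sX : is_subgroup (gen (fun y => exists i, y = x i)).
  by split; [exact: gen_one|split; [exact: gen_mul|exact: gen_inv]].
pose K := subgroup sX; pose v (u : K) : S := sval u.
have vM : is_hom v by [].
have [|phi [phiM [phix _]]] := freeS.2 K _ (fun i =>
    exist _ (x i) (gen_base (ex_intro (fun j => x i = x j) i erefl))).
  by case=> a Ha /(hom_derived vM)/freeS.1 va; apply: eq_exist.
have [|psi [psiM [psix psiU]]] := freeS.2 S _ x; first exact: freeS.1.
have <- : v (phi g) = g.
  rewrite -[LHS]/((v \o phi) g) (psiU _ (hom_comp phiM vM)) => [|i].
    by rewrite -(psiU id).
  by rewrite /= phix.
exact: svalP.
Qed.

Lemma free_solvable_endo (y : 'I_r -> S) :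
  exists2 phi : S -> S, is_hom phi & forall i, phi (x i) = y i.
Proof. by have [phi [phiM [phix _]]] := freeS.2 S freeS.1 y; exists phi. Qed.

Lemma free_solvable_magnus k : k <= d ->
  exists2 D : S -> magnus r k, is_hom D & forall i, D (x i) = magnus_gen k i.
Proof.
move=> lekd; have [|D [DM [Dx _]]] := freeS.2 (magnus r k) _ (@magnus_gen r k).
  by move=> g /(derived_leq lekd); apply: derived_magnus.
by exists D.
Qed.

(** Write [h] as a word in the basis. A solution [y] in [H] of the corresponding equation defines an
    endomorphism sending [x i] to [y i]. *)
Lemma verbally_closed_endo (H : S -> Prop) h : is_subgroup H ->
  verbally_closed H -> H h ->
  exists phi : S -> S, [/\ is_hom phi, forall g, H (phi g) & phi h = h].
Proof.
move=> sH vH Hh; have [w wh] := gen_word (free_solvable_gen h).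
have [|y [Hy wy]] := vH _ w h Hh; first by exists x.
have [phi phiM phix] := free_solvable_endo y.
exists phi; split=> // [g|]; last first.
  by rewrite -[in LHS]wh hom_weval // -wy; congr weval; apply/funext.
elim: (free_solvable_gen g) => [_ [i ->]||a b _ IHa _ IHb|a _ IHa].
- by rewrite phix.
- by rewrite (hom1 phiM); apply: sH.1.
- by rewrite phiM; apply: sH.2.1.
- by rewrite (homV phiM); apply: sH.2.2.
Qed.

End FreeSolvable.

(** * The kernel of the Magnus homomorphism *)

Definition spow (G : groupType) (b : bool) (g : G) : G := if b then (g^-1)%g else g.

Definition signed (P : Type) (l : seq (bool * P)) : seq (int * P) :=
  [seq ((-1) ^+ (c.1 : bool), c.2)%R | c <- l].

(** Modulo commutators of elements of [derived k] the factors commute, and the first one cancels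
    against an occurrence of the opposite sign; induction on the length. *)
Lemma prod_spow_derived (S : AbsGroup) k (P : eqType) (val : P -> S)
    (l : seq (bool * P)) :
  (forall c, c \in l -> derived k (val c.2)) ->
  (forall p, wsum (signed l) (fun q => (q == p)%:R%R) = 0%R) ->
  derived k.+1 (\prod_(c <- l) spow c.1 (val c.2))%g.
Proof.
have dspow b g : derived k (g : S) -> derived k (spow b g).
  by case: b => //=; apply: derivedV.
have dprod (l' : seq (bool * P)) : (forall c, c \in l' -> derived k (val c.2)) ->
    derived k (\prod_(c <- l') spow c.1 (val c.2))%g.
  elim: l' => [|c l' IH] dl; first by rewrite big_nil; apply: derived1.
  rewrite big_cons; apply: derivedM; first by apply/dspow/dl; rewrite mem_head.
  by apply: IH => c' c'l; apply: dl; rewrite in_cons c'l orbT.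
have [n] := ubnP (size l); elim: n l => // n IH [|[s p] l] ltn dl l0.
  by rewrite big_nil; apply: derived1.
(* If every other occurrence of [p] had the sign [s], the exponent sum of [p] would not be zero. *)
have spl : (~~ s, p) \in l.
  apply: contraT => spl; have := l0 p; rewrite /wsum /= big_cons /= eqxx mulr1.
  rewrite big_map (eq_big_seq (fun c => ((-1) ^+ s * (c.2 == p)%:R)%R)).
    rewrite -mulr_sumr -{1}[((-1) ^+ s)%R]mulr1 -mulrDr => /eqP.
    rewrite mulf_eq0 signr_eq0 /= paddr_eq0 ?oner_eq0 //.
    by apply: sumr_ge0 => c _; rewrite ler0n.
  move=> [s' p'] cl /=; case: eqP => [E|]; rewrite ?mulr0 // !mulr1.
  by have [->//|/negPf] := eqVneq s' s; case: s s' spl cl {ltn dl l0} => -[] //=;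
     rewrite E => /negP.
case/splitPr: spl ltn dl l0 => l1 l2 ltn dl l0.
have dp : derived k (val p) by apply: (dl (s, p)); rewrite mem_head.
have dl1 c : c \in l1 -> derived k (val c.2).
  by move=> cl; apply: dl; rewrite in_cons mem_cat cl orbT.
have dl2 c : c \in l2 -> derived k (val c.2).
  by move=> cl; apply: dl; rewrite in_cons mem_cat in_cons cl !orbT.
rewrite big_cons big_cat big_cons /=; set a := spow s _.
have -> : spow (~~ s) (val p) = (a^-1)%g by rewrite /a; case: (s) => /=; rewrite ?invgK.
set A := (\prod_(c <- l1) _)%g; set B := (\prod_(c <- l2) _)%g.
have -> : (a * (A * (a^-1 * B)) = (a * A * a^-1 * A^-1) * (A * B))%g.
  by rewrite !mulgA mulgVK.
apply: (@derivedM _ k.+1); first by apply: derived_comm; [apply: dspow|apply: dprod].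
rewrite -big_cat; apply: IH => [|c|q].
- by move: ltn; rewrite /= !size_cat /=; lia.
- by rewrite mem_cat => /orP[/dl1|/dl2].
- rewrite -[RHS](l0 q) /wsum /signed !big_map big_cons !big_cat big_cons /=.
  by rewrite signrN; ring.
Qed.

Section Paths.
Variables (r : nat) (S G : AbsGroup) (x : 'I_r -> S) (D : S -> G).
Hypothesis genx : forall g, gen (fun y => exists i, y = x i) g.
Hypothesis DM : is_hom D.

Definition crossed (T : S -> G -> int) :=
  forall g h b, T (g * h)%g b = (T g b + T h ((D g)^-1 * b)%g)%R.

(* The list [l] is the path from the identity spelled by a word for [g] in the
   Cayley graph of the image of [D]; the last clause is Reidemeister-Schreier
   rewriting with respect to a section [t]. *)
Lemma path_of g : exists l : seq (bool * (G * 'I_r)),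
  [/\ forall c, c \in l -> exists h, D h = c.2.1,
     forall T, crossed T -> forall b,
       T g b = wsum (signed l) (fun p => T (x p.2) (p.1^-1 * b)%g) &
     forall (t : G -> S) b, (t b * g * (t (b * D g))^-1)%g =
       (\prod_(c <- l) spow c.1
         (t (b * c.2.1) * x c.2.2 * (t (b * c.2.1 * D (x c.2.2)))^-1))%g].
Proof.
have T1 T : crossed T -> forall b, T 1%g b = 0%R.
  move=> cT b; have := cT 1%g 1%g b; rewrite (hom1 DM) invg1 !mul1g => /eqP.
  by rewrite -subr_eq subrr eq_sym => /eqP.
elim: (genx g) => [_ [i ->]||a a' _ [l [lD lT lt]] _ [l' [lD' lT' lt']]|
                   a _ [l [lD lT lt]]].
- exists [:: (false, (1%g, i))]; split=> [c|T cT b|t b].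
  + by rewrite inE => /eqP->; exists 1%g; apply: (hom1 DM).
  + by rewrite /wsum big_seq1 /= expr0 mul1r invg1 mul1g.
  + by rewrite big_seq1 /= !mulg1.
- exists [::]; split=> [//|T cT b|t b]; first by rewrite T1 // /wsum big_nil.
  by rewrite big_nil (hom1 DM : D (gone S) = _) !mulg1 mulgV.
- exists (l ++ [seq (c.1, ((D a * c.2.1)%g, c.2.2)) | c <- l']).
  split=> [c|T cT b|t b].
  + rewrite mem_cat => /orP[/lD//|/mapP[c' /lD'[h' h'c] ->]].
    by exists (a * h')%g; rewrite (homM DM) h'c.
  + rewrite -[gmul a a']/(a * a')%g cT lT // lT' // /signed map_cat wsum_cat.
    congr (_ + _)%R; rewrite /wsum !big_map; apply: eq_bigr => c _ /=.
    by rewrite invgM mulgA.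
  + rewrite -[gmul a a']/(a * a')%g (homM DM) big_cat big_map /=.
    transitivity ((t b * a * (t (b * D a))^-1) *
        (t (b * D a) * a' * (t (b * D a * D a'))^-1))%g.
      by rewrite !mulgA mulgVK.
    rewrite lt lt'; congr (_ * _)%g; apply: eq_bigr => c _ /=.
    by rewrite !mulgA.
- exists (rev [seq (~~ c.1, (((D a)^-1 * c.2.1)%g, c.2.2)) | c <- l]).
  split=> [c|T cT b|t b].
  + rewrite mem_rev => /mapP[c' /lD[h' h'c] ->].
    by exists (a^-1 * h')%g; rewrite (homM DM) (homV DM) h'c.
  + have := cT (a^-1)%g a b; rewrite mulVg T1 // (homV DM) invgK lT // => /eqP.
    rewrite eq_sym addr_eq0 => /eqP.
    rewrite -[ginv a]/(a^-1)%g => ->; rewrite /wsum /signed map_rev !big_map.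
    rewrite -map_rev big_map big_rev big_map -sumrN /=; apply: eq_bigr => c _ /=.
    by rewrite signrN mulNr invgM invgK mulgA.
  + rewrite -[ginv a]/(a^-1)%g (homV DM).
    have E := lt t (b * (D a)^-1)%g; rewrite mulgVK in E.
    have := congr1 (fun z => z^-1)%g E; rewrite !invgM !invgK mulgA => ->.
    rewrite -{1}(revK l) -prodgV -map_rev big_map.
    apply: eq_bigr => c _ /=; rewrite !mulgA; case: c.1 => //=.
    by rewrite invgK.
Qed.

End Paths.

Section MagnusStep.
Variables (r : nat) (S G : AbsGroup) (x : 'I_r -> S) (D : S -> G) (D1 : S -> wr G r).
Hypothesis genx : forall g, gen (fun y => exists i, y = x i) g.
Hypotheses (DM : is_hom D) (D1M : is_hom D1).
Hypothesis D1x : forall i, D1 (x i) = Wr (fun p => (p == (1%g, i))%:R%R) (D (x i)).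

Lemma base_D1 g : base (D1 g) = D g.
Proof.
apply: (hom_ext genx (hom_comp D1M (_ : is_hom (@base G r))) DM) => // i.
by rewrite /= D1x.
Qed.

Lemma flow_D1M g h b j :
  flow (D1 (g * h)%g) (b, j) =
  (flow (D1 g) (b, j) + flow (D1 h) (((D g)^-1 * b)%g, j))%R.
Proof. by rewrite (homM D1M) flowM base_D1. Qed.

Lemma flow_path g : exists l : seq (bool * (G * 'I_r)),
  [/\ forall c, c \in l -> exists h, D h = c.2.1,
     forall T, crossed D T -> forall b,
       T g b = wsum (signed l) (fun p => T (x p.2) (p.1^-1 * b)%g),
     forall p, flow (D1 g) p = wsum (signed l) (fun q => (q == p)%:R%R) &
     forall (t : G -> S) b, (t b * g * (t (b * D g))^-1)%g =
       (\prod_(c <- l) spow c.1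
         (t (b * c.2.1) * x c.2.2 * (t (b * c.2.1 * D (x c.2.2)))^-1))%g].
Proof.
have [l [lD lT lt]] := path_of genx DM g; exists l; split=> // -[b j].
rewrite (lT (fun g b => flow (D1 g) (b, j))) => [|a a' c]; last exact: flow_D1M.
apply: eq_wsum => -[c i] /=; rewrite D1x flow_Wr; congr (nat_of_bool _)%:R%R.
rewrite !xpair_eqE; congr (_ && _); last exact: eq_sym.
by rewrite -(inj_eq (mulgI c)) mulVKg mulg1 eq_sym.
Qed.

(** With a section [t] of [D] on its image, a conjugate of [g] is a product of Schreier elements,
    which lie in the kernel of [D]. Their exponent sums are the values of the flow of [g], all zero,
    so [prod_spow_derived] applies. *)
Lemma ker_step k : (forall g, D g = 1%g -> derived k g) ->
  forall g, D1 g = 1%g -> derived k.+1 g.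
Proof.
move=> kerD g D1g; have Dg : D g = 1%g by rewrite -base_D1 D1g.
have [l [lD _ lflow lt]] := flow_path g.
have /choice[t Ht] (b : G) : exists t, (exists h, D h = b) -> D t = b.
  have [[h hb]|H] := pselect (exists h, D h = b); first by exists h.
  by exists 1%g => -[h hb]; case: H; exists h.
have := lt t 1%g; rewrite mul1g Dg => E.
suff : derived k.+1 (t 1 * g * (t 1)^-1)%g.
  by move/(derivedJ (t 1)^-1)%g; rewrite invgK !mulgA mulgVK mulVg mul1g.
rewrite E; under eq_bigr do rewrite !mul1g.
apply: (@prod_spow_derived _ _ _ (fun p => t p.1 * x p.2 * (t (p.1 * D (x p.2)))^-1)%g).
  move=> c /lD cD; apply: kerD; rewrite !(homM DM) (homV DM) !Ht //.
    by rewrite mulgV.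
  by case: cD => h hc; exists (h * x c.2.2)%g; rewrite (homM DM) hc.
by move=> p; rewrite -lflow D1g.
Qed.

End MagnusStep.

Section MagnusKernel.
Variables (r d : nat) (S : AbsGroup) (x : 'I_r -> S).
Hypothesis freeS : is_free_solvable d x.

Lemma magnus_kernel k (D : S -> magnus r k) : k <= d ->
  is_hom D -> (forall i, D (x i) = magnus_gen k i) ->
  forall g, D g = 1%g <-> derived k g.
Proof.
move=> lekd DM Dx g; split=> [|/(hom_derived DM)]; last exact: derived_magnus.
elim: k D lekd DM Dx g => [//|k IH] D lekd DM Dx g.
have [D0 D0M D0x] := free_solvable_magnus freeS (ltnW lekd).
apply: (ker_step (free_solvable_gen freeS) D0M) => // [i|].
  by rewrite Dx D0x.
exact: IH D0 (ltnW lekd) D0M D0x.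
Qed.

End MagnusKernel.

(** * The abelianization *)

Section Abelianization.
Variables (r d : nat) (S : AbsGroup) (x : 'I_r -> S).
Hypotheses (d_gt0 : 0 < d) (freeS : is_free_solvable d x).
Variable D : S -> magnus r 1.
Hypotheses (DM : is_hom D) (Dx : forall i, D (x i) = magnus_gen 1 i).

Definition abel (g : S) : 'rV[int]_r := (\row_j flow (D g) (1%g, j))%R.

Lemma abelM g h : abel (g * h)%g = (abel g + abel h)%R.
Proof.
apply/rowP => j; rewrite !mxE (homM DM) flowM.
rewrite -[LHS]/(flow (D g) (1%g, j) + shift (base (D g)) (flow (D h)) (1%g, j))%R.
by congr (_ + flow (D h) (_, j))%R; case: (base _).
Qed.

Lemma abel1 : abel 1%g = 0%R.
Proof. by apply: (addrI (abel 1%g)); rewrite -abelM mulg1 addr0. Qed.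

Lemma abelV g : abel (g^-1)%g = (- abel g)%R.
Proof. by apply: (addrI (abel g)); rewrite -abelM mulgV subrr abel1. Qed.

Lemma abelX g n : abel (g ^+ n)%g = (abel g *+ n)%R.
Proof. by elim: n => [|n IH]; rewrite ?abel1 // expgS abelM IH mulrS. Qed.

Lemma abel_eq0 g : abel g = 0%R <-> derived 1 g.
Proof.
rewrite -(magnus_kernel freeS d_gt0 DM Dx); split=> [g0|Dg]; last first.
  by apply/rowP => j; rewrite !mxE Dg.
apply: wr_eqP; last by case: (base _).
by apply/funext => -[[] j]; move/rowP/(_ j): g0; rewrite !mxE.
Qed.

Lemma abel_x i : abel (x i) = delta_mx 0%R i.
Proof. by apply/rowP => j; rewrite !mxE Dx flow_Wr xpair_eqE !eqxx /= eq_sym. Qed.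

Lemma abel_comb (P : S -> Prop) k (c : 'I_k -> int) (v : 'I_k -> 'rV[int]_r) :
  is_subgroup P -> (forall i, exists2 g, P g & abel g = v i) ->
  exists2 g, P g & abel g = (\sum_i c i *: v i)%R.
Proof.
case=> P1 [PM PV] Pv; apply: (big_ind (fun w => exists2 g, P g & abel g = w)).
- by exists 1%g; rewrite ?abel1.
- by move=> _ _ [g Pg <-] [h Ph <-]; exists (g * h)%g; rewrite ?abelM //; apply: PM.
move=> i _; have [g Pg <-] := Pv i; have PX n : P (g ^+ n)%g.
  by elim: n => [|n IH]; rewrite ?expgS //; apply: PM.
rewrite -[c i]intz scaler_int; case: (c i) => n; first by exists (g ^+ n)%g; rewrite ?abelX.
by exists (g ^- n.+1)%g; [apply: PV|rewrite abelV abelX].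
Qed.

Lemma abel_surj v : exists g, abel g = v.
Proof.
have [||g _ gE] :=
    @abel_comb (fun _ => True) r (fun i => v 0%R i) (fun i => abel (x i)).
- by [].
- by move=> i; exists (x i).
exists g; rewrite gE [RHS]row_sum_delta.
by apply: eq_bigr => i _; rewrite abel_x.
Qed.

Section Closed.
Variable H : S -> Prop.
Hypotheses (sH : is_subgroup H) (vH : verbally_closed H).

(** Take [g] with [abel g = v] and an endomorphism [phi] with image in [H] fixing [h]. Then
    [abel (phi g)] and [v] have the same [n]-th multiple, and Z^r is torsion-free. *)
Lemma abel_pure v (n : int) : n != 0%R ->
  (exists2 h, H h & abel h = (n *: v)%R) -> exists2 h, H h & abel h = v.
Proof.
move=> n0 [h Hh hv]; have [g gv] := abel_surj v.
have [phi [phiM Hphi phih]] := verbally_closed_endo freeS sH vH Hh.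
exists (phi g) => //; have [h' Hh' hv'] : exists2 h', phi h' = h' & abel h' = (v *+ `|n|)%R.
  move: hv; rewrite -{1}[n]intz scaler_int; case: n {n0} => m; first by exists h.
  move=> hv; exists (h^-1)%g; first by rewrite (homV phiM) phih.
  by rewrite abelV hv opprK.
have /(hom_derived phiM)/abel_eq0 : derived 1 (h' * (g ^+ `|n|)^-1)%g.
  by apply/abel_eq0; rewrite abelM abelV abelX hv' gv subrr.
rewrite (homM phiM) (homV phiM) (homX phiM) abelM abelV abelX Hh' hv' -mulrnBl.
move/rowP => E; apply/rowP => j; move/eqP: (E j).
by rewrite mulmxnE !mxE mulrn_eq0 absz_eq0 (negPf n0) subr_eq0 => /eqP.
Qed.

(** Take the Smith normal form of the matrix of generators. If all diagonal entries are nonzero,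
    purity puts the rows of the invertible matrix [R] in the image of [H], which is then everything.
    A zero entry would leave only [r - 1] generators. *)
Lemma verbally_closed_abel : r_ab_eq H r -> forall g, exists2 h, H h & derived 1 (g * h^-1)%g.
Proof.
case=> -[s [Hs sgen]] rmin g.
suff [h Hh hg] : exists2 h, H h & abel h = abel g.
  by exists h => //; apply/abel_eq0; rewrite abelM abelV hg subrr.
pose T := (\matrix_i abel (s i))%R.
have [L uL [R uR [e _ defT]]] := int_Smith_normal_form T.
set E := (\matrix_(i, j) _)%R in defT.
have row_diag i : row i (E *m R)%R = (e`_i *: row i R)%R.
  rewrite row_mul; apply/rowP => j; rewrite !mxE (bigD1 i) //= !mxE eqxx mulr1n.
  rewrite big1 ?addr0 // => k; rewrite -val_eqE => /negPf ki.
  by rewrite !mxE eq_sym ki mulr0n mul0r.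
have HE i : exists2 h, H h & abel h = row i (E *m R)%R.
  have [|h Hh hE] := @abel_comb H r (fun j => invmx L i j) (fun j => abel (s j)) sH.
    by move=> j; exists (s j).
  exists h => //; rewrite hE -[(E *m R)%R](mulKmx uL) (mulmxA L) -defT.
  apply/rowP => j; rewrite !mxE summxE; apply: eq_bigr => k _; by rewrite !mxE.
have [[i0 ei0]|e0] := pselect (exists i : 'I_r, (e`_i)%R = 0%R); last first.
  have [|h Hh hE] := @abel_comb H r (fun i => (abel g *m invmx R)%R 0%R i) (fun i => row i R) sH.
    move=> i; apply: (@abel_pure _ (e`_i)%R); first by apply/eqP => ei; apply: e0; exists i.
    by rewrite -row_diag.
  by exists h => //; rewrite hE -mulmx_sum_row mulmxKV.
have /fin_all_exists2[t Ht tE] i := HE (lift i0 i).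
have : r <= r.-1; last by have := ltn_ord i0; lia.
apply: rmin; exists t; split=> // h /sgen hgen.
have [c hc] : exists c, abel h = (c *m (E *m R))%R.
  suff [c ->] : exists c, abel h = (c *m T)%R.
    by exists (c *m L)%R; rewrite defT !mulmxA.
  elim: hgen => [a [[i ->]|/abel_eq0 ->]||a b _ [ca Ea] _ [cb Eb]|a _ [ca Ea]].
  - by exists (delta_mx 0%R i); rewrite -rowE rowK.
  - by exists 0%R; rewrite mul0mx.
  - by exists 0%R; rewrite mul0mx abel1.
  - by exists (ca + cb)%R; rewrite abelM Ea Eb mulmxDl.
  - by exists (- ca)%R; rewrite abelV Ea mulNmx.
pose P := gen (fun a => (exists i, a = t i) \/ derived 1 a).
have sP : is_subgroup P.
  by split; [exact: gen_one|split; [exact: gen_mul|exact: gen_inv]].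
have [|h' Ph' h'E] := @abel_comb P _ (fun i => c 0%R (lift i0 i)) (fun i => abel (t i)) sP.
  by move=> i; exists (t i) => //; apply: gen_base; left; exists i.
rewrite -[h](mulgVK h'); apply: gen_mul => //; apply: gen_base; right.
apply/abel_eq0; rewrite abelM abelV h'E hc mulmx_sum_row (bigD1_ord i0) //=.
rewrite row_diag ei0 scale0r scaler0 add0r; apply/eqP; rewrite subr_eq0; apply/eqP.
by apply: eq_bigr => i _; rewrite tE.
Qed.

End Closed.
End Abelianization.

(** * Rigidity of the elements (c - 1) m *)

Lemma eventually_all (T : eqType) (P : T -> nat -> Prop) (L : seq T) :
  (forall e, exists N, forall n, N <= n -> P e n) ->
  exists N, forall n e, N <= n -> e \in L -> P e n.
Proof.
move=> ev; elim: L => [|e L [N HN]]; first by exists 0.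
have [M HM] := ev e; exists (maxn M N) => n e'; rewrite geq_max => /andP[leM leN].
by rewrite inE => /orP[/eqP->|]; [apply: HM|apply: HN].
Qed.

Section TorsionFree.
Variable G : AbsGroup.
Hypothesis tfG : torsion_free G.

Lemma trapped_eq1 (F : seq G) (e b : G) :
  (forall q, (e ^+ q * b)%g \in F) -> e = 1%g.
Proof.
move=> eF; pose L := [seq (e ^+ q * b)%g | q <- iota 0 (size F).+1].
have /(uniqPn (1%g : G))[q [q' [ltqq' ltq' E]]] : ~~ uniq L.
  apply/negP => uL; suff : size L <= size F by rewrite size_map size_iota ltnn.
  by apply: uniq_leq_size => // _ /mapP[q _ ->].
rewrite size_map size_iota in ltq'.
rewrite !(nth_map 0) ?size_iota ?nth_iota ?add0n // in E; last 2 first.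
- by apply: ltn_trans ltq'.
- by apply: ltn_trans ltq'.
move/mulIg: E => E; apply: (tfG (n := (q' - q).-1)).
rewrite prednK ?subn_gt0 //; apply: (mulIg (e ^+ q)%g).
by rewrite -expgnDr subnK ?mul1g // ltnW.
Qed.

(** A nonempty set stable under translation by an element of infinite order is infinite; in module
    terms, [c - 1] is injective on finitely supported functions. *)
Lemma invariant_eq0 (K : seq G) (h : G -> int) (c : G) : c <> 1%g ->
  (forall b, h b <> 0%R -> b \in K) -> (forall b, h (c * b)%g = h b) ->
  forall b, h b = 0%R.
Proof.
move=> c1 hK hc b; apply: contrapT => hb; apply: c1.
apply: (@trapped_eq1 K c b) => q; apply: hK.
by elim: q => [|q IH]; rewrite ?mul1g // expgS -mulgA hc.
Qed.

End TorsionFree.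

(** The exponent sum of the [l]-th generator, read at the lowest level [magnus r 1], where flows are
    integer vectors. *)
Fixpoint magnus_ab r k (l : 'I_r) : magnus r k.+1 -> int :=
  if k is k'.+1 then fun u => @magnus_ab r k' l (base u)
  else fun u => flow u (1%g, l).

Lemma magnus_abM r k l (u v : magnus r k.+1) :
  magnus_ab l (u * v)%g = (magnus_ab l u + magnus_ab l v)%R.
Proof.
elim: k u v => [|k IH] u v /=; last by rewrite -IH.
rewrite -[LHS]/(flow u (1%g, l) + shift (base u) (flow v) (1%g, l))%R.
by congr (_ + flow v (_, l))%R; case: (base u).
Qed.

Lemma magnus_ab1 r k l : magnus_ab l (1%g : magnus r k.+1) = 0%R.
Proof.
by apply: (addrI (magnus_ab l (1%g : magnus r k.+1))); rewrite -magnus_abM mulg1 addr0.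
Qed.

Lemma magnus_abV r k l (u : magnus r k.+1) :
  magnus_ab l (u^-1)%g = (- magnus_ab l u)%R.
Proof.
by apply: (addrI (magnus_ab l u)); rewrite -magnus_abM mulgV subrr magnus_ab1.
Qed.

Lemma magnus_abX r k l (u : magnus r k.+1) n :
  magnus_ab l (u ^+ n)%g = (magnus_ab l u * n%:Z)%R.
Proof.
elim: n => [|n IH]; first by rewrite magnus_ab1 mulr0.
by rewrite expgS magnus_abM IH; lia.
Qed.

Lemma magnus_ab_gen r k (i l : 'I_r) :
  magnus_ab l (magnus_gen k.+1 i) = (i == l)%:R%R.
Proof.
elim: k => [|k IH]; last exact: IH.
rewrite -[LHS]/(((1%g : magnus r 0, l) == (1%g, i))%:R)%R.
by rewrite xpair_eqE eqxx eq_sym.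
Qed.

Section Peel.
Variables (r d k : nat) (S : AbsGroup) (x : 'I_r -> S).
Hypotheses (freeS : is_free_solvable d x) (lekd : k.+2 <= d).
Notation W := (magnus r k.+1).
Variables (D : S -> W) (D1 : S -> wr W r).
Hypotheses (DM : is_hom D) (D1M : is_hom D1).
Hypothesis Dx : forall i, D (x i) = magnus_gen k.+1 i.
Hypothesis D1x : forall i, D1 (x i) = magnus_gen k.+2 i.

Let genx := free_solvable_gen freeS.

Lemma magnus_D1x i : D1 (x i) = Wr (fun p => (p == (1%g, i))%:R%R) (D (x i)).
Proof. by rewrite D1x Dx. Qed.

Lemma endo_D phi g h : is_hom phi -> D g = D h -> D (phi g) = D (phi h).
Proof.
move=> phiM E; have : D (g * h^-1)%g = 1%g by rewrite (homM DM) (homV DM) E mulgV.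
move/(magnus_kernel freeS (ltnW lekd) DM Dx)/(hom_derived phiM).
move/(magnus_kernel freeS (ltnW lekd) DM Dx).
by rewrite (homM phiM) (homV phiM) (homM DM) (homV DM) => /divg1_eq.
Qed.

Lemma endo_D1 phi g h : is_hom phi -> D1 g = D1 h -> D1 (phi g) = D1 (phi h).
Proof.
move=> phiM E; have : D1 (g * h^-1)%g = 1%g by rewrite (homM D1M) (homV D1M) E mulgV.
move/(magnus_kernel freeS lekd D1M D1x)/(hom_derived phiM).
move/(magnus_kernel freeS lekd D1M D1x).
by rewrite (homM phiM) (homV phiM) (homM D1M) (homV D1M) => /divg1_eq.
Qed.

Lemma D_D1 g : D g = base (D1 g).
Proof. by rewrite (base_D1 genx DM D1M magnus_D1x). Qed.

Lemma endo_D_eq1 phi m : is_hom phi -> D m = 1%g -> D (phi m) = 1%g.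
Proof.
by move=> phiM m1; rewrite -(hom1 DM) -(hom1 phiM); apply: endo_D; rewrite ?(hom1 DM).
Qed.

Lemma flow_finite g : exists K : seq W, forall b j, flow (D1 g) (b, j) <> 0%R -> b \in K.
Proof.
have [l [_ _ lflow _]] := flow_path genx DM D1M magnus_D1x g.
exists [seq c.2.1 | c <- l] => b j; rewrite lflow => H; apply: contrapT => bl; apply: H.
rewrite /wsum big_map big1_seq // => c /= cl; case: eqP => [E|_]; last by rewrite mulr0.
by case: bl; apply/mapP; exists c; rewrite ?E.
Qed.

Lemma D1_eq g h : D g = D h -> (forall b j, flow (D1 g) (b, j) = flow (D1 h) (b, j)) ->
  D1 g = D1 h.
Proof.
move=> E Ef; apply: wr_eqP; last by rewrite -!D_D1.
by apply/funext => -[b j].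
Qed.

Lemma flowJ c m b j : D m = 1%g ->
  flow (D1 (c * m * c^-1)%g) (b, j) = flow (D1 m) (((D c)^-1 * b)%g, j).
Proof.
move=> m1; rewrite !(flow_D1M genx DM D1M magnus_D1x) (homM DM) m1 mulg1.
have := flow_D1M genx DM D1M magnus_D1x c (c^-1)%g b j.
rewrite mulgV (hom1 D1M) flow1 => /eqP.
by rewrite eq_sym addrC addr_eq0 addrAC => /eqP ->; rewrite subrr add0r.
Qed.

(** In module notation the commutator of [c] and [m] is [(c - 1) m]. *)
Lemma flow_commutator c m b j : D m = 1%g ->
  flow (D1 (c * m * c^-1 * m^-1)%g) (b, j) =
  (flow (D1 m) (((D c)^-1 * b)%g, j) - flow (D1 m) (b, j))%R.
Proof.
move=> m1; rewrite (flow_D1M genx DM D1M magnus_D1x) flowJ //; congr (_ + _)%R.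
rewrite !(homM DM) (homV DM) m1 mulg1 mulgV invg1 mul1g (homV D1M) flowV.
by rewrite -D_D1 m1 invg1 shift1.
Qed.

Lemma D_commutator c m : D m = 1%g -> D (c * m * c^-1 * m^-1)%g = 1%g.
Proof. by move=> m1; rewrite !(homM DM) !(homV DM) m1 mulg1 mulgV invg1 mulg1. Qed.

Lemma pm1_of_mul (q : nat) (a : int) : (a * q%:Z = 1)%R -> q = 1 /\ a = 1%R.
Proof.
move=> E; have /eqP : absz (a * q%:Z)%R = 1 by rewrite E.
by rewrite abszM muln_eq1 => /andP[_ /eqP/= q1]; rewrite q1 mulr1 in E.
Qed.

(* Put c' = D (phi c).  The equation (c' - 1) phi(m) = (c - 1) m forces, for n
   larger than anything seen in the finite set of quotients of support points
   of m, every support point f of m to satisfy c^-1 c'^q f in supp m for some q;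
   comparing abelianizations q = 1 or q = -1, uniformly in f, so that c^-1 c'^q
   permutes a finite set and c' = c or c' = c^-1. *)
Lemma peel (m g : S) (i : 'I_r) : D m = 1%g -> D1 m <> 1%g ->
  D g = magnus_gen k.+1 i ->
  exists N, forall n, N <= n ->
    let c := (g ^+ n.+1)%g in let m1 := (c * m * c^-1 * m^-1)%g in
    D1 m1 <> 1%g /\ forall phi, is_hom phi -> D1 (phi m1) = D1 m1 ->
      D1 (phi (phi m)) = D1 m /\ D (phi (phi c)) = D c.
Proof.
move=> Dm D1m Dg; have tfW : torsion_free W by apply: torsion_free_magnus.
pose t b j := flow (D1 m) (b, j); have [F tF] := flow_finite m.
have [b0 [j0 tb0]] : exists b j, t b j <> 0%R.
  apply: contrapT => H; apply: D1m; rewrite -(hom1 D1M); apply: D1_eq.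
    by rewrite Dm (hom1 DM).
  move=> b j; rewrite (hom1 D1M); apply: contrapT => H'; apply: H; exists b, j.
  exact: H'.
pose E := [seq (b * b'^-1)%g | b <- F, b' <- F].
(* Beyond the bound, no nontrivial quotient of support points is an [n.+1]-st power, and exponent
   sums of quotients are too small to be nonzero multiples of [n.+1]. *)
pose P (e : W) n := (e <> 1%g -> forall u : W, (u ^+ n.+1)%g <> e) /\
                    forall l, (`|magnus_ab l e| <= n)%N.
have [e|N HN] := @eventually_all _ P E.
  have [M HM] : exists M, forall l, (`|magnus_ab l e| <= M)%N.
    by exists (\max_l `|magnus_ab l e|)%N => l; apply: leq_bigmax.
  have [e1|/eqP/(@bounded_roots_magnus r k.+1)[N HN]] := eqVneq e 1%g.
    by exists M => n leMn; split=> [//|l]; apply: leq_trans (HM l) leMn.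
  exists (maxn M N) => n; rewrite geq_max => /andP[leM leN].
  by split=> [_ u|l]; [apply: HN|apply: leq_trans (HM l) leM].
exists N => n leNn c m1.
have inE' b b' j j' : t b j <> 0%R -> t b' j' <> 0%R -> (b * b'^-1)%g \in E.
  by move=> /tF bF /tF b'F; apply/allpairsP; exists (b, b').
have Dc : D c = (magnus_gen k.+1 i ^+ n.+1)%g by rewrite (homX DM) Dg.
have Dc1 : D c <> 1%g.
  move=> /(congr1 (magnus_ab i)); rewrite Dc magnus_abX magnus_ab_gen eqxx magnus_ab1.
  by rewrite mul1r.
have D1m1 : D1 m1 <> 1%g.
  move=> E1; apply: tb0; apply: (@invariant_eq0 _ tfW F (t^~ j0) (D c)^-1%g).
  - by move/(congr1 (fun z => z^-1)%g); rewrite invgK invg1.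
  - by move=> b; apply: tF.
  - move=> b; have := flow_commutator c b j0 Dm; rewrite -/m1 E1 flow1 => /eqP.
    by rewrite eq_sym subr_eq0 => /eqP.
split=> // phi phiM phim1.
pose u := D (phi g); pose c' := D (phi c).
have c'E : c' = (u ^+ n.+1)%g by rewrite /c' (homX phiM) (homX DM).
pose t' b j := flow (D1 (phi m)) (b, j); have [F' t'F'] := flow_finite (phi m).
have Dphim : D (phi m) = 1%g by apply: endo_D_eq1.
have eqt b j : (t' (c'^-1 * b)%g j - t' b j = t ((D c)^-1 * b)%g j - t b j)%R.
  rewrite -[RHS](flow_commutator c b j Dm) -/m1 -phim1 /m1.
  by rewrite !(homM phiM) !(homV phiM) flow_commutator.
have c'1 : c' <> 1%g.
  move=> c'1; apply: D1m1; rewrite -(hom1 D1M); apply: D1_eq.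
    by rewrite D_commutator // (hom1 DM).
  move=> b j; rewrite flow_commutator // -/(t _ _) -/(t b j) -eqt c'1 invg1 mul1g.
  by rewrite subrr (hom1 D1M).
have c'E1 q b b' j j' : t b j <> 0%R -> t b' j' <> 0%R -> (c' ^+ q.+1)%g <> (b * b'^-1)%g.
  move=> tb tb' E1; have [|H _] := HN (n.+1 * q.+1).-1 _ _ (inE' _ _ _ _ tb tb'); first by lia.
  case: (pselect ((b * b'^-1)%g = 1%g)) => [E2|/H/(_ u)]; last first.
    by apply; rewrite -E1 c'E -expgnA; congr (_ ^+ _)%g; lia.
  by apply: c'1; apply: (tfW _ q); rewrite E1.
(* Without such a [q], [t'] is constant on the points [c'^q f] with [q >= 0] and on those with
   [q < 0], so it vanishes at [f] and at [c'^-1 f] by finiteness of its support; at [f] the equation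
   [eqt] then reads [t f = 0]. *)
have step f j : t f j <> 0%R -> exists q : nat,
   t ((D c)^-1 * (c' ^+ q * f))%g j <> 0%R \/ t ((D c)^-1 * (c' ^- q * f))%g j <> 0%R.
  move=> tf; apply: contrapT => H.
  have Hp q : t ((D c)^-1 * (c' ^+ q * f))%g j = 0%R.
    by apply: contrapT => Hq; apply: H; exists q; left.
  have Hn q : t ((D c)^-1 * (c' ^- q * f))%g j = 0%R.
    by apply: contrapT => Hq; apply: H; exists q; right.
  have tp q : t (c' ^+ q.+1 * f)%g j = 0%R.
    by apply: contrapT => tq; apply: (c'E1 q _ _ _ _ tq tf); rewrite mulgK.
  have tn q : t (c' ^- q.+1 * f)%g j = 0%R.
    apply: contrapT => tq; apply: (c'E1 q _ _ _ _ tf tq).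
    by rewrite invgM invgK mulVKg.
  have t'0 : t' f j = 0%R.
    apply: contrapT => t'f; apply: c'1; apply: (@trapped_eq1 _ tfW F' c' f) => q.
    apply: (t'F' _ j); rewrite -/(t' _ _); suff -> : t' (c' ^+ q * f)%g j = t' f j by [].
    elim: q => [|q IH]; first by rewrite mul1g.
    have := eqt (c' ^+ q.+1 * f)%g j; rewrite Hp tp subrr => /eqP.
    by rewrite subr_eq0 {1}expgS -mulgA mulKg => /eqP <-.
  have t'1 : t' (c'^-1 * f)%g j = 0%R.
    apply: contrapT => t'f; apply: c'1; apply: invg_inj; rewrite invg1.
    apply: (@trapped_eq1 _ tfW F' (c'^-1)%g (c'^-1 * f)%g) => q.
    apply: (t'F' _ j); rewrite -/(t' _ _).
    suff -> : t' ((c'^-1) ^+ q * (c'^-1 * f))%g j = t' (c'^-1 * f)%g j by [].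
    elim: q => [|q <-]; first by rewrite mul1g.
    have := eqt (c' ^- q.+1 * f)%g j; rewrite Hn tn subrr => /eqP.
    rewrite -!expVgn subr_eq0 => /eqP; rewrite mulgA -expgS expgSr -mulgA => ->.
    by rewrite expgSr -mulgA.
  have := eqt f j; rewrite t'0 t'1; have := Hp 0; rewrite mul1g => ->.
  by rewrite subr0 sub0r => /eqP; rewrite eq_sym oppr_eq0 => /eqP.
have dvd_small l (e : W) (a : int) : e \in E ->
    ((i == l)%:R * n.+1%:Z = a * n.+1%:Z + magnus_ab l e -> (i == l)%:R = a)%R.
  move=> eE; have [_ /(_ l)] := HN n e leNn eE.
  by move: (magnus_ab l e) ((i == l)%:R)%R => z y; nia.
have abc' l : magnus_ab l c' = (magnus_ab l u * n.+1%:Z)%R by rewrite c'E magnus_abX.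
have [ce [ceE Hce]] : exists ce, (ce = c' \/ ce = (c'^-1)%g) /\
    forall f j, t f j <> 0%R -> t ((D c)^-1 * (ce * f))%g j <> 0%R.
  (* Exponent sums of the [i]-th generator give [1 = a q] or [1 = - a q] with [a = magnus_ab i u].
     So [q = 1], and the sign is that of [a], the same for every support point. *)
  have key f j : t f j <> 0%R ->
     (magnus_ab i u = 1%R /\ t ((D c)^-1 * (c' * f))%g j <> 0%R) \/
     (magnus_ab i u = (-1)%R /\ t ((D c)^-1 * (c'^-1 * f))%g j <> 0%R).
    move=> tf; have [q [tq|tq]] := step f j tf; have eE := inE' _ _ _ _ tf tq.
    - have /(congr1 (magnus_ab i)) : D c = (c' ^+ q * (f * ((D c)^-1 * (c' ^+ q * f))^-1))%g.
        by rewrite !invgM invgK !mulgA mulgK mulgV mul1g.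
      rewrite {1}Dc magnus_abX magnus_ab_gen magnus_abM magnus_abX abc' mulrAC.
      move/(dvd_small _ _ _ eE); rewrite eqxx => /esym/pm1_of_mul[q1 u1].
      by left; rewrite q1 in tq.
    - have /(congr1 (magnus_ab i)) : D c = (c' ^- q * (f * ((D c)^-1 * (c' ^- q * f))^-1))%g.
        by rewrite !invgM !invgK !mulgA mulgK mulVg mul1g.
      rewrite {1}Dc magnus_abX magnus_ab_gen magnus_abM magnus_abV magnus_abX abc' mulrAC.
      rewrite -mulNr -mulNr; move/(dvd_small _ _ _ eE); rewrite eqxx => /esym/pm1_of_mul[q1 u1].
      by right; rewrite q1 in tq; split=> //; lia.
  have [[u1 _]|[u1 _]] := key _ _ tb0.
    exists c'; split=> [|f j /key[[_ //]|[u2 _]]]; first by left.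
    by rewrite u1 in u2.
  exists (c'^-1)%g; split=> [|f j /key[[u2 _]|[_ //]]]; first by right.
  by rewrite u1 in u2.
have cec : ce = D c.
  apply: (mulgI (D c)^-1%g); rewrite mulVg.
  apply: (@trapped_eq1 _ tfW F _ b0) => q; apply: (tF _ j0).
  elim: q => [|q IH]; first by rewrite mul1g.
  by rewrite expgS -!mulgA; apply: Hce.
case: ceE => ceE.
  have c'c : c' = D c by rewrite -ceE cec.
  have phim : D1 (phi m) = D1 m.
    apply: D1_eq => [|b j]; first by rewrite Dphim.
    apply/eqP; rewrite -subr_eq0; apply/eqP.
    apply: (@invariant_eq0 _ tfW (F ++ F') (fun b => t' b j - t b j)%R (D c)^-1%g).
    - by move/(congr1 (fun z => z^-1)%g); rewrite invgK invg1.
    - move=> b'; rewrite mem_cat; case: (eqVneq (t b' j) 0%R) => [->|/eqP/tF->//].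
      by rewrite subr0 => /t'F'->; rewrite orbT.
    - move=> b'; have := eqt b' j; rewrite c'c /=.
      move: (t' ((D c)^-1 * b')%g j) (t' b' j) (t ((D c)^-1 * b')%g j) (t b' j).
      by clear=> *; lia.
  by split; [rewrite (endo_D1 phiM phim)|rewrite (endo_D phiM c'c)].
(* Here [phi] inverts [c] modulo the kernel of [D], and [eqt] forces [phi m = c m^-1 c^-1] modulo
   the kernel of [D1]; a second application of [phi] restores [m]. *)
have c'c : c' = ((D c)^-1)%g by rewrite -cec ceE invgK.
have t'E b j : t' b j = (- t ((D c)^-1 * b)%g j)%R.
  apply/eqP; rewrite -addr_eq0; apply/eqP.
  apply: (@invariant_eq0 _ tfW (F' ++ [seq (D c * b)%g | b <- F])
    (fun b => t' b j + t ((D c)^-1 * b)%g j)%R (D c)) => // b'.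
  - rewrite mem_cat; case: (eqVneq (t' b' j) 0%R) => [->|/eqP/t'F'->//].
    rewrite add0r => /tF tb'; apply/orP; right; apply/mapP.
    by exists ((D c)^-1 * b')%g; rewrite ?mulVKg.
  - have := eqt b' j; rewrite c'c invgK mulKg /=.
    move: (t' (D c * b')%g j) (t' b' j) (t ((D c)^-1 * b')%g j) (t b' j).
    by clear=> *; lia.
have phim : D1 (phi m) = D1 (c * m^-1 * c^-1)%g.
  have Dm' : D (m^-1)%g = 1%g by rewrite (homV DM) Dm invg1.
  apply: D1_eq => [|b j]; first by rewrite !(homM DM) Dm' mulg1 (homV DM) mulgV.
  rewrite flowJ // (homV D1M) flowV -D_D1 Dm invg1 shift1; exact: t'E.
have Dphim' : D (phi m^-1)%g = 1%g by rewrite (homV phiM) (homV DM) Dphim invg1.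
split; last first.
  have phic : D (phi c) = D (c^-1)%g by rewrite (homV DM).
  by rewrite (endo_D phiM phic) (homV phiM) (homV DM) -/c' c'c invgK.
rewrite (endo_D1 phiM phim) !(homM phiM) (homV phiM c).
apply: D1_eq => [|b j]; first by rewrite !(homM DM) Dphim' mulg1 (homV DM) mulgV.
rewrite flowJ // (homV phiM) (homV D1M) flowV -D_D1 Dphim invg1 shift1.
rewrite -[LHS]/(- t' ((D (phi c))^-1 * b)%g j)%R t'E opprK -/c' c'c invgK mulKg.
by [].
Qed.

End Peel.

(** * Lifting from S^(k) to S^(k+1) *)

Section LeftMultiple.
Local Open Scope ring_scope.
Variables (r k : nat).
Notation W := (magnus r k.+1).
Variables (N : 'I_r -> seq (int * (W * 'I_r))) (B : W -> Prop).
Hypothesis sB : is_subgroup B.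
Hypothesis NB : forall i c, c \in N i -> B c.2.1.
Hypothesis N0 : forall i q j,
  wsum (N i) (fun c => ((base (c.1 : wr (magnus r k) r), c.2) == (q, j))%:R) = 0.

Let n i j b := wsum (N i) (fun p => (p == (b, j))%:R).

Lemma shift_wsum i j u b :
  wsum (N i) (fun p => (((u * p.1)%g, p.2) == (b, j))%:R) = n i j (u^-1 * b)%g.
Proof.
apply: eq_wsum => -[c l] /=; rewrite !xpair_eqE; congr (_ && _)%:R.
by apply/eqP/eqP => [<-|->]; rewrite ?mulKg ?mulVKg.
Qed.

Lemma n_support i j b : n i j b <> 0 -> b \in [seq c.2.1 | c <- N i].
Proof.
move=> H; apply: contrapT => bN; apply: H; apply: big1_seq => c /= cN.
case: eqP => [E|_]; last by rewrite mulr0.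
by case: bN; apply/mapP; exists c; rewrite ?E.
Qed.

Lemma n_B i j b : n i j b <> 0 -> B b.
Proof. by move/n_support/mapP => [c /NB Bc ->]. Qed.

(* The equation reads y e_j0 = v (1 - N).  A solution supported on the whole of W
   is restricted to a left coset of B on which y is nonzero, and translated. *)
Lemma left_multiple (j0 : 'I_r) :
  exists (F : seq W) (y : W -> int) (v : 'I_r -> W -> int),
  [/\ uniq F, forall u, u \in F -> B u, exists2 u, u \in F & y u <> 0 &
    forall j b, \sum_(u <- F) y u * ((u, j0) == (b, j))%:R =
      \sum_(u <- F) \sum_i v i u * (((u, i) == (b, j))%:R -
         wsum (N i) (fun p => (((u * p.1)%g, p.2) == (b, j))%:R))].
Proof.
(* Row [ord0] is the basis vector [e_j0] and the others are the rows of [N - 1]: these are [r + 1]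
   rows of length [r], so [strong_rank] gives a relation. *)
pose a (s : 'I_r.+1) (j : 'I_r) (b : W) : int :=
  if unlift ord0 s is Some i then n i j b - (b == 1%g)%:R * (i == j)%:R
  else (b == 1%g)%:R * (j0 == j)%:R.
pose K := 1%g :: flatten [seq [seq c.2.1 | c <- N i] | i <- enum 'I_r].
have aK s j b : a s j b <> 0 -> b \in K.
  rewrite /a /K in_cons; have [//|_] := eqVneq b 1%g; rewrite /= mul0r.
  case: unliftP => [i _|_ //]; rewrite mul0r subr0 => /n_support bN.
  by apply/flattenP; exists [seq c.2.1 | c <- N i] => //; apply: map_f; rewrite mem_enum.
have [F [c [uF cF Hc]]] := strong_rank (@folner_magnus r k.+1) aK.
pose y u := c ord0 u; pose v (i : 'I_r) u := c (lift ord0 i) u.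
have delta u b (i j : 'I_r) :
    ((u, i) == (b, j))%:R = ((u^-1 * b)%g == 1%g :> W)%:R * (i == j)%:R :> int.
  rewrite xpair_eqE -mulnb natrM; congr ((nat_of_bool _)%:R * _).
  by apply/eqP/eqP => [->|E]; [rewrite mulVg|apply: (mulgI u^-1%g); rewrite E mulVg].
have main j b : \sum_(u <- F) y u * ((u, j0) == (b, j))%:R =
      \sum_(u <- F) \sum_i v i u * (((u, i) == (b, j))%:R - n i j (u^-1 * b)%g).
  apply/eqP; rewrite -subr_eq0 -sumrB; apply/eqP.
  rewrite -[RHS](Hc j b); apply: eq_bigr => u _.
  rewrite big_ord_recl /a unlift_none delta -sumrN; congr (_ + _).
  by apply: eq_bigr => i _; rewrite liftK delta -mulrN opprB.
have [u0 u0F yu0] : exists2 u, u \in F & y u <> 0.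
  apply: contrapT => y0; have y0' u : u \in F -> y u = 0.
    by move=> uF'; apply: contrapT => yu; apply: y0; exists u.
  have [s [u uF' csu]] := cF.
  have v0 : forall j b, b \in F -> v j b = 0.
    apply: (@augmentation_fixed_eq0 (magnus r k) r F v N uF N0) => j b.
    have := main j b; rewrite [LHS]big1_seq => [|w /y0'->]; last by rewrite mul0r.
    under eq_bigr do under eq_bigr do rewrite mulrBr.
    under eq_bigr do rewrite sumrB.
    rewrite sumrB => /esym/eqP; rewrite subr_eq0 => /eqP E.
    under [RHS]eq_bigr do under eq_bigr do rewrite shift_wsum.
    rewrite -E exchange_big /= (bigD1 j) //= [X in _ + X]big1 => [|i /negPf ij]; last first.
      by rewrite big1 // => w _; rewrite xpair_eqE ij andbF mulr0.
    rewrite addr0; case: ifP => bF.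
      rewrite (bigD1_seq b) //= eqxx mulr1 big1 ?addr0 // => w /negPf wb.
      by rewrite xpair_eqE wb mulr0.
    rewrite big1_seq // => w /= wF; rewrite xpair_eqE; case: eqP => [wb|_]; last by rewrite mulr0.
    by rewrite wb bF in wF.
  case: (unliftP ord0 s) csu => [i|] -> csu; apply: csu.
    exact: v0.
  exact: y0'.
pose G := [seq (u0^-1 * u)%g | u <- F & `[< B (u0^-1 * u)%g >]].
have GE (R : zmodType) (f : W -> R) : (forall u, u \in F -> ~ B (u0^-1 * u)%g -> f u = 0) ->
    \sum_(u <- F) f u = \sum_(u <- G) f (u0 * u)%g.
  move=> f0; rewrite big_map big_filter [RHS]big_mkcond; apply: eq_big_seq => u uF'.
  by rewrite mulVKg; case: ifPn => // /asboolPn; apply: f0.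
have GB u : u \in G -> B u by case/mapP=> w; rewrite mem_filter => /andP[/asboolP Bw _] ->.
have Bdiv (u b : W) : B (u^-1 * b)%g -> B b -> B u.
  move=> Bub Bb; rewrite -[u]invgK; apply: sB.2.2.
  rewrite -[(u^-1)%g](mulgK b); apply: sB.2.1 => //; exact: sB.2.2.
exists G, (fun u => y (u0 * u)%g), (fun i u => v i (u0 * u)%g); split=> //.
- by rewrite map_inj_uniq ?filter_uniq //; apply: mulgI.
- exists 1%g; rewrite ?mulg1 //; apply/mapP; exists u0; rewrite ?mulVg //.
  by rewrite mem_filter u0F andbT mulVg; apply/asboolP; apply: sB.1.
move=> j b; have [Bb|nBb] := pselect (B b); last first.
  rewrite big1_seq => [|u /= /GB Bu]; last first.
    by rewrite xpair_eqE; case: eqP => [ub|_]; [rewrite ub in Bu|rewrite mulr0].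
  rewrite big1_seq // => u /= /GB Bu; rewrite big1 // => i _.
  rewrite xpair_eqE; case: eqP => [ub|_]; first by rewrite ub in Bu.
  rewrite sub0r shift_wsum; have [-> //|/eqP/n_B Bub] := eqVneq (n i j (u^-1 * b)%g) 0.
    by rewrite oppr0 mulr0.
  by case: nBb; rewrite -[b](mulVKg u); apply: sB.2.1.
have deltal u (i : 'I_r) : (((u0 * u)%g, i) == ((u0 * b)%g, j)) = ((u, i) == (b, j)).
  by rewrite !xpair_eqE (inj_eq (mulgI u0)).
have := main j (u0 * b)%g; rewrite GE => [|u uF' nBu]; last first.
  rewrite xpair_eqE; case: eqP => [ub|_]; last by rewrite mulr0.
  by case: nBu; rewrite ub mulKg.
rewrite GE => [|u uF' nBu]; last first.
  rewrite big1 // => i _; rewrite xpair_eqE; case: eqP => [ub|_].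
    by case: nBu; rewrite ub mulKg.
  rewrite sub0r; have [->|/eqP/n_B Bub] := eqVneq (n i j (u^-1 * (u0 * b))%g) 0.
    by rewrite oppr0 mulr0.
  by case: nBu; apply: (Bdiv _ b) => //; rewrite invgM invgK -mulgA.
under eq_bigr do rewrite deltal; move=> ->.
apply: eq_bigr => u _; apply: eq_bigr => i _.
by rewrite deltal shift_wsum invgM -mulgA mulKg.
Qed.

End LeftMultiple.

Section Lift.
Variables (r d k : nat) (S : AbsGroup) (x : 'I_r -> S).
Hypotheses (freeS : is_free_solvable d x) (lekd : k.+2 <= d).
Notation W := (magnus r k.+1).
Variables (D : S -> W) (D1 : S -> wr W r).
Hypotheses (DM : is_hom D) (D1M : is_hom D1).
Hypothesis Dx : forall i, D (x i) = magnus_gen k.+1 i.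
Hypothesis D1x : forall i, D1 (x i) = magnus_gen k.+2 i.
Variable H : S -> Prop.
Hypotheses (sH : is_subgroup H) (vH : verbally_closed H).
Hypothesis HD : forall g, exists2 h, H h & D h = D g.

Let genx := free_solvable_gen freeS.
Let endoD := endo_D freeS lekd DM Dx.
Let endoD1 := endo_D1 freeS lekd D1M D1x.
Let DD1 := D_D1 freeS DM D1M Dx D1x.
Let fDM := flow_D1M genx DM D1M (magnus_D1x Dx D1x).
Let fpath := flow_path genx DM D1M (magnus_D1x Dx D1x).

Lemma sub_exp h n : H h -> H (h ^+ n)%g.
Proof.
move=> Hh; elim: n => [|n IH]; first exact: sH.1.
by rewrite expgS; apply: sH.2.1.
Qed.

(* The generator g_i is peeled off with two coprime exponents, so that fixing both
   powers fixes g_i itself. *)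
Lemma rigid_list (g : 'I_r -> S) (l : seq 'I_r) (m : S) :
  (forall i, H (g i)) -> (forall i, D (g i) = magnus_gen k.+1 i) ->
  H m -> D m = 1%g -> D1 m <> 1%g ->
  exists h, [/\ H h, D h = 1%g, D1 h <> 1%g & forall phi, is_hom phi ->
    (forall a, H (phi a)) -> D1 (phi h) = D1 h ->
    exists psi, [/\ is_hom psi, forall a, H (psi a), D1 (psi m) = D1 m &
      forall i, i \in l -> D (psi (g i)) = D (g i)]].
Proof.
move=> Hg Dg; elim: l m => [|i l IH] m Hm Dm D1m.
  by exists m; split=> // phi phiM Hphi phim; exists phi.
have HX n a : H a -> H (g i ^+ n.+1 * a * (g i ^+ n.+1)^-1 * a^-1)%g.
  move=> Ha; have Hc := sub_exp n.+1 (Hg i); apply: sH.2.1; last exact: sH.2.2.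
  by apply: sH.2.1; [apply: sH.2.1|apply: sH.2.2].
have [N1 HN1] := peel freeS lekd DM D1M Dx D1x Dm D1m (Dg i).
have [] := HN1 N1 (leqnn _); set n1 := N1; set c1 := (g i ^+ n1.+1)%g.
set m1 := (_ * m^-1)%g => D1m1 Hphi1.
have Dm1 : D m1 = 1%g by apply: D_commutator.
have [N2 HN2] := peel freeS lekd DM D1M Dx D1x Dm1 D1m1 (Dg i).
(* The second exponent is [(n1 + 1) N2 + 1], congruent to 1 modulo the first exponent [n1 + 1]; the
   factor [N2] meets the bound. *)
have [] := HN2 (n1.+1 * N2) _; first by rewrite leq_pmull.
set c2 := (g i ^+ _)%g; set m2 := (_ * m1^-1)%g => D1m2 Hphi2.
have Dm2 : D m2 = 1%g by apply: D_commutator.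
have [h [Hh Dh D1h Hphi]] := IH m2 (HX _ _ (HX _ _ Hm)) Dm2 D1m2.
exists h; split=> // phi phiM Hphi' phih.
have [psi [psiM Hpsi psim2 psig]] := Hphi phi phiM Hphi' phih.
have [psim1 psic2] := Hphi2 psi psiM psim2.
pose psi2 := psi \o psi; have psi2M : is_hom psi2 by apply: hom_comp.
have [psim psic1] := Hphi1 psi2 psi2M psim1.
(* Each peeling costs one squaring: modulo the kernels of [D1] and [D], [psi^2] fixes [m1] and [c2],
   and [psi^4] fixes [m], [c1] and still [c2]. *)
exists (psi2 \o psi2); split=> [||//|j].
- exact: hom_comp.
- by move=> a; apply: Hpsi.
have fix4 a : D (psi2 a) = D a -> D (psi2 (psi2 a)) = D a.
  by move=> E; rewrite (endoD psi2M E).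
rewrite in_cons => /orP[/eqP->|/psig E]; last first.
  by apply: fix4; rewrite /psi2 /= (endoD psiM E).
move/(fix4 c2): psic2; move: psic1; rewrite /= /c1 /c2.
rewrite !(homX psi2M) !(homX DM); set u := D (psi2 _); set w := D (g i) => E1 E2.
rewrite (expgS u) (expgS w) !expgnA E1 in E2.
exact: mulIg E2.
Qed.

(** [rigid_list] packs [m] and lifts of all generators into one element of [H], and verbal
    closedness is applied to that element. Fixing the lifts modulo the kernel of [D] makes [psi]
    induce the identity there. *)
Lemma rigid (m : S) : H m -> D m = 1%g -> D1 m <> 1%g ->
  exists psi, [/\ is_hom psi, forall a, H (psi a), D1 (psi m) = D1 m &
    forall g, D (psi g) = D g].
Proof.
move=> Hm Dm D1m; have /fin_all_exists2[g Hg gD] i := HD (x i).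
have Dg i : D (g i) = magnus_gen k.+1 i by rewrite gD.
have [h [Hh Dh D1h Hphi]] := rigid_list (enum 'I_r) Hg Dg Hm Dm D1m.
have [phi [phiM Hphi' phih]] := verbally_closed_endo freeS sH vH Hh.
have [|psi [psiM Hpsi psim psig]] := Hphi phi phiM Hphi'; first by rewrite phih.
exists psi; split=> //; apply: (hom_ext genx (hom_comp psiM DM) DM) => i /=.
rewrite (endoD psiM (esym (gD i))) psig ?gD //.
by rewrite mem_enum.
Qed.

(** This realizes a combination of elements of the kernel of [D] with group ring coefficients:
    integers act by powers, group elements by conjugation with a preimage in [P]. One [m] serves all
    [psi] that are trivial modulo the kernel of [D], because such maps act linearly. *)
Lemma act_list (P : S -> Prop) (l : seq (int * (W * S))) : is_subgroup P ->
  (forall c, c \in l ->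
     [/\ exists2 h, P h & D h = c.2.1, P c.2.2 & D c.2.2 = 1%g]) ->
  exists m, [/\ P m, D m = 1%g & forall psi, is_hom psi ->
    (forall g, D (psi g) = D g) -> forall b j,
    flow (D1 (psi m)) (b, j) =
      wsum l (fun p => flow (D1 (psi p.2)) ((p.1^-1 * b)%g, j))].
Proof.
case=> P1 [PM PV]; elim: l => [|[z [u a]] l IH] Hl.
  exists 1%g; split=> // [|psi psiM _ b j]; first exact: hom1.
  by rewrite (hom1 psiM) (hom1 D1M) flow1 /wsum big_nil.
have [|m [Pm Dm Hm]] := IH; first by move=> c cl; apply: Hl; rewrite in_cons cl orbT.
have [[h Ph /= Dh] /= Pa Da] := Hl _ (mem_head _ _).
have PX n : P (a ^+ n)%g.
  by elim: n => [//|n IHn]; rewrite expgS; apply: PM.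
have DX n : D (a ^+ n)%g = 1%g by rewrite (homX DM) Da expg1n.
have fX n psi b j : is_hom psi -> (forall g, D (psi g) = D g) ->
    flow (D1 (psi (a ^+ n)%g)) (b, j) = (n%:Z * flow (D1 (psi a)) (b, j))%R.
  move=> psiM psiD; rewrite (homX psiM) (homX D1M) flowX; last by rewrite -DD1 psiD Da.
  by rewrite natmulfctE -mulr_natl natz.
have [az [Paz Daz faz]] : exists az, [/\ P az, D az = 1%g & forall psi b j, is_hom psi ->
    (forall g, D (psi g) = D g) ->
    flow (D1 (psi az)) (b, j) = (z * flow (D1 (psi a)) (b, j))%R].
  case: z {Hl} => n.
    by exists (a ^+ n)%g; split=> // psi b j psiM psiD; rewrite fX.
  exists (a ^- n.+1)%g; split; [exact: PV|by rewrite (homV DM) DX invg1|].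
  move=> psi b j psiM psiD; rewrite (homV psiM) (homV D1M) flowV.
  rewrite -DD1 psiD DX invg1 shift1.
  by rewrite -[LHS]/(- flow (D1 (psi (a ^+ n.+1)%g)) (b, j))%R fX // NegzE mulNr.
exists (h * az * h^-1 * m)%g; split.
- by apply: (PM) => //; apply: (PM); [apply: (PM)|apply: (PV)].
- by rewrite !(homM DM) Daz Dm (homV DM) !mulg1 mulgV.
move=> psi psiM psiD b j; rewrite !(homM psiM) (homV psiM) fDM.
rewrite (flowJ freeS DM D1M Dx D1x) ?psiD // !(homM DM) (homV DM) !psiD Daz mulg1.
by rewrite mulgV invg1 mul1g (Hm psi) // (faz psi) // /wsum big_cons /= Dh.
Qed.

Lemma lift_gen (j0 : 'I_r) : exists2 h, H h & D1 h = D1 (x j0).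
Proof.
have /fin_all_exists2[g Hg gD] i := HD (x i).
pose a i := (x i * (g i)^-1)%g.
have Da i : D (a i) = 1%g by rewrite (homM DM) (homV DM) gD mulgV.
suff [h Hh hE] : exists2 h, H h & D1 h = D1 (a j0).
  exists (h * g j0)%g; first exact: sH.2.1.
  by rewrite (homM D1M) hE -(homM D1M) mulgVK.
have [theta thetaM thetax] := free_solvable_endo freeS g.
have Htheta u : H (theta u).
  elim: (genx u) => [_ [i ->]||b c _ Hb _ Hc|b _ Hb].
  - by rewrite thetax.
  - by rewrite (hom1 thetaM); apply: sH.1.
  - by rewrite thetaM; apply: sH.2.1.
  - by rewrite (homV thetaM); apply: sH.2.2.
have thetaD : forall u, D (theta u) = D u.
  by apply: (hom_ext genx (hom_comp thetaM DM) DM) => i /=; rewrite thetax.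
have /fin_all_exists[l Hl] i := fpath (a i).
pose N i := signed (l i).
have flowa i p : flow (D1 (a i)) p = wsum (N i) (fun q => (q == p)%:R%R).
  by have [_ _ ->] := Hl i.
have flowtheta i b j : flow (D1 (theta (a i))) (b, j) =
    (flow (D1 (a i)) (b, j) -
     wsum (N i) (fun p => flow (D1 (a p.2)) ((p.1^-1 * b)%g, j)))%R.
  have [_ lT _ _] := Hl i.
  (* [T] is a derivation with [T (x n)] the flow of [a n], since [x n = a n * g n] and
     [theta (x n) = g n]. The path formula at [a i] therefore gives row [i] of [N ^ 2]. *)
  pose T u b := (flow (D1 u) (b, j) - flow (D1 (theta u)) (b, j))%R.
  have cT : crossed D T.
    by move=> u w c; rewrite /T (homM thetaM) !fDM thetaD; ring.
  have E : flow (D1 (theta (a i))) (b, j) = (flow (D1 (a i)) (b, j) - T (a i) b)%R.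
    by rewrite /T; ring.
  rewrite E (lT T cT); congr (_ - _)%R; apply: eq_wsum => -[c n] /=.
  rewrite /T thetax -[x n in LHS](mulgVK (g n)) -/(a n) fDM Da invg1 mul1g.
  by rewrite addrK.
(* The flow one level below is also a derivation. It vanishes at [a i] because [D (a i) = 1], which
   says that row [i] of [N] dies in the group ring of [magnus r k]. *)
have N0 i q j : wsum (N i) (fun c =>
    ((base (c.1 : wr (magnus r k) r), c.2) == (q, j))%:R)%R = 0%R.
  have [_ lT _ _] := Hl i.
  have Dx' n : D (x n) = Wr (fun p => (p == (1%g, n))%:R%R) (magnus_gen k n).
    exact: Dx.
  pose T u (b : W) := flow (D u : wr (magnus r k) r) (base (b : wr (magnus r k) r), j).
  have cT : crossed D T by move=> u w c; rewrite /T (homM DM).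
  have := lT T cT (Wr 0%R q : wr (magnus r k) r); rewrite /T Da flow1 => ->.
  apply: eq_wsum => -[c n] /=; rewrite Dx' flow_Wr !xpair_eqE.
  congr (nat_of_bool (_ && _))%:R%R; last exact: eq_sym.
  by apply/eqP/eqP => [<-|/mulg1_eq]; [exact: mulVg|rewrite invgK].
pose B (b : W) := exists h, D h = b.
have sB : is_subgroup B.
  split; first by exists 1%g; apply: hom1.
  split=> [_ _ [u <-] [w <-]|_ [u <-]]; first by exists (u * w)%g; apply: homM.
  by exists (u^-1)%g; apply: homV.
have NB i c : c \in N i -> B c.2.1.
  by case/mapP=> c' cl ->; have [/(_ _ cl)] := Hl i.
have [F [y [v [uF FB yF Hyv]]]] := left_multiple sB NB N0 j0.
have FH u : u \in F -> exists2 h, H h & D h = u.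
  by move=> /FB[h <-]; apply: HD.
(* [m] is the combination of the [theta (a i)] with coefficients [v], an element of [H]; [m'] below
   is [y a_j0]. *)
have [|m [Hm Dm flowm]] := @act_list H
    [seq (v i u, (u, theta (a i))) | u <- F, i <- enum 'I_r] sH.
  move=> _ /allpairsP[[u i] /= [uF' _ ->]] /=; split=> //; first exact: FH.
  by rewrite thetaD.
have [||m' [_ Dm' flowm']] := @act_list (fun _ => True)
    [seq (y u, (u, a j0)) | u <- F].
- by [].
- by move=> _ /mapP[u /FH[h _ hu] ->] /=; split=> //; exists h.
have flowm'E psi : is_hom psi -> (forall g, D (psi g) = D g) -> forall b j,
    flow (D1 (psi m')) (b, j) =
    (\sum_(u <- F) y u * flow (D1 (psi (a j0))) ((u^-1 * b)%g, j))%R.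
  by move=> psiM psiD b j; rewrite flowm' // /wsum big_map.
(* In coordinates, [v (N - N ^ 2) = v (1 - N) N = y e_j0 N]. *)
have mm' : D1 m = D1 m'.
  apply: (D1_eq freeS DM D1M Dx D1x) => [|b j]; first by rewrite Dm Dm'.
  rewrite (flowm id) // (flowm'E id) // /wsum big_allpairs_dep /=.
  pose h (p : W * 'I_r) := flow (D1 (a p.2)) ((p.1^-1 * b)%g, j).
  pose L1 := [seq (y u, (u, j0)) | u <- F].
  pose L2 := [seq (v ui.2 ui.1, ui) | ui <- [seq (u, i) | u <- F, i <- enum 'I_r]].
  pose L3 := [seq ((- (v ui.2 ui.1 * c.1))%R, ((ui.1 * c.2.1)%g, c.2.2)) |
             ui <- [seq (u, i) | u <- F, i <- enum 'I_r], c <- N ui.2].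
  have L23 f : wsum (L2 ++ L3) f = (\sum_(u <- F) \sum_i v i u * (f (u, i) -
      wsum (N i) (fun c => f ((u * c.1)%g, c.2))))%R.
    rewrite wsum_cat /wsum big_map !big_allpairs_dep /= -big_split /=.
    apply: eq_bigr => u _; rewrite !big_enum -big_split /=; apply: eq_bigr => i _.
    rewrite mulrBr; congr (_ + _)%R; rewrite -mulrN -sumrN mulr_sumr.
    by apply: eq_bigr => c _; rewrite mulNr mulrN mulrA.
  transitivity (wsum (L2 ++ L3) h).
    rewrite L23; apply: eq_bigr => u _; rewrite big_enum; apply: eq_bigr => i _ /=.
    rewrite flowtheta; congr (_ * (_ - _))%R; apply: eq_wsum => c.
    by rewrite /h /= invgM mulgA.
  rewrite -(@wsum_ext _ L1) => [|[c n]]; first by rewrite /wsum big_map.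
  by rewrite L23 -Hyv /wsum big_map.
have conv0 (f : W -> int) : (exists K : seq W, forall b, f b <> 0%R -> b \in K) ->
    (forall b, \sum_(u <- F) y u * f (u^-1 * b)%g = 0)%R -> forall b, f b = 0%R.
  case=> K fK fy; apply: (conv_eq0 (@unique_product_magnus r k.+1) uF yF fK fy).
have finite u : exists K : seq W, forall b j, flow (D1 u) (b, j) <> 0%R -> b \in K.
  exact: (flow_finite freeS DM D1M Dx D1x).
(* When [D1 m] is trivial [rigid] does not apply, but then [y a_j0 = 0] and already [a_j0 = 0]. *)
have [m1|m1] := pselect (D1 m = 1%g).
  exists 1%g; first exact: sH.1.
  rewrite (hom1 D1M); apply/esym; rewrite -(hom1 D1M).
  apply: (D1_eq freeS DM D1M Dx D1x) => [|b j]; first by rewrite Da (hom1 DM).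
  rewrite (hom1 D1M) flow1; move: b; apply: conv0 => [|b].
    by have [K HK] := finite (a j0); exists K => b; apply: HK.
  by rewrite -(flowm'E id) // -mm' m1 flow1.
have [psi [psiM Hpsi psim psiD]] := rigid Hm Dm m1.
exists (psi (a j0)) => //.
apply: (D1_eq freeS DM D1M Dx D1x) => [//|b j].
apply/eqP; rewrite -subr_eq0; apply/eqP; move: b; apply: conv0 => [|b].
  have [K HK] := finite (a j0); have [K' HK'] := finite (psi (a j0)).
  exists (K ++ K') => b; rewrite mem_cat.
  case: (eqVneq (flow (D1 (a j0)) (b, j)) 0%R) => [->|/eqP/HK->//].
  by rewrite subr0 => /HK'->; rewrite orbT.
under eq_bigr do rewrite mulrBr; rewrite sumrB -(flowm'E id) // -(flowm'E psi) //.
by rewrite -mm' -(endoD1 psiM mm') psim subrr.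
Qed.

Lemma lift_all g : exists2 h, H h & D1 h = D1 g.
Proof.
elim: (genx g) => [_ [i ->]||a b _ [u Hu uE] _ [w Hw wE]|a _ [u Hu uE]].
- exact: lift_gen.
- by exists 1%g => //; apply: sH.1.
- by exists (u * w)%g; [apply: sH.2.1|rewrite (homM D1M) uE wE -(homM D1M)].
- by exists (u^-1)%g; [apply: sH.2.2|rewrite (homV D1M) uE -(homV D1M)].
Qed.

End Lift.

Theorem theorem2 (r d : nat) (S : AbsGroup) (x : 'I_r -> S) (H : S -> Prop) :
  1 <= r -> 1 <= d ->
  @is_free_solvable S r d x ->
  is_subgroup H -> fin_gen H -> verbally_closed H -> r_ab_eq H r ->
  forall g : S, H g.
Proof.
move=> _ d_gt0 freeS sH _ vH rH.
(* The case [k = d - 1] is enough: the kernel of that [D] is the [d]-th derived subgroup, which is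
   trivial. *)
suff lift k : k < d -> forall D : S -> magnus r k.+1, is_hom D ->
    (forall i, D (x i) = magnus_gen k.+1 i) ->
    forall g, exists2 h, H h & D h = D g.
  have ltd : d.-1 < d by rewrite prednK.
  have [D DM Dx] := free_solvable_magnus freeS ltd.
  move=> g; have [h Hh hg] := lift _ ltd D DM Dx g.
  suff -> : g = h by [].
  have /(magnus_kernel freeS ltd DM Dx) : D (g * h^-1)%g = 1%g.
    by rewrite (homM DM) (homV DM) hg mulgV.
  by rewrite prednK // => /freeS.1 gh; apply: divg1_eq.
elim: k => [|k IH] ltkd D DM Dx g.
  have [h Hh gh] := verbally_closed_abel d_gt0 freeS DM Dx sH vH rH g.
  exists h => //; apply/esym/divg1_eq; rewrite -(homV DM) -(homM DM).
  exact/(magnus_kernel freeS ltkd DM Dx).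
have [D0 D0M D0x] := free_solvable_magnus freeS (ltnW ltkd).
exact: (lift_all freeS ltkd D0M DM D0x Dx sH vH (IH (ltnW ltkd) D0 D0M D0x)).
Qed.
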